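(* Let $\Gamma$ be a rooted tree, directed away from its root, with $\operatorname{height}(\Gamma)=n-1$. Then for every integer $t$ with $n\ge t\ge2$, $$\operatorname{pd}(R/I_t(L_n))\le\operatorname{pd}(R/I_t(\Gamma))\le\operatorname{ara}(I_t(\Gamma)),$$ where $L_n$ is the line graph on $n$ vertices.
   Context: A tree is a finite simple graph in which any two distinct vertices are joined by a unique path. A tree $\Gamma$ is viewed as a directed graph by choosing any vertex to be the root and directing every edge away from the root. A path of length $t$ in a directed graph is a sequence of $t$ vertices $v_1,\ldots,v_t$ such that $(v_j,v_{j+1})$ is a directed edge for $j=1,\ldots,t-1$ (length counts vertices). The level of a vertex $x$ is the length of the unique path from the root to $x$ minus one, and $\operatorname{height}(\Gamma)$ is the maximum of the levels of the vertices of $\Gamma$. The line graph $L_n$ is the directed tree with vertices $x_1,\ldots,x_n$ and directed edges $(x_j,x_{j+1})$, $j=1,\ldots,n-1$. Let $k$ be a field. For a directed graph $\Gamma$, the vertices of $\Gamma$ are identified with the variables of a polynomial ring $R$ over $k$, and the path ideal $I_t(\Gamma)\subseteq R$ is generated by the monomials $v_1\cdots v_t$ over all paths $v_1,\ldots,v_t$ of length $t$. In each expression, $R$ denotes the polynomial ring over $k$ in the vertices of the graph concerned. $\operatorname{pd}$ is projective dimension over $R$, and $\operatorname{ara}(I)$ is the minimal number $s$ for which there exist $f_1,\ldots,f_s\in R$ with $\sqrt I=\sqrt{(f_1,\ldots,f_s)}$. *)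

(* Defs.v *)
From HB Require Import structures.
From mathcomp Require Import all_boot all_algebra.
From mathcomp Require Import boolp.
From mathcomp.multinomials Require Import mpoly.

Set Implicit Arguments.
Unset Strict Implicit.
Unset Printing Implicit Defensive.

Import GRing.Theory.

Local Open Scope ring_scope.
Local Open Scope quotient_scope.

(* Extended natural numbers; None stands for +oo. *)
Definition natinf := option nat.

Definition natinf_le (x y : natinf) : bool :=
  match x, y with
  | _, None => true
  | None, Some _ => false
  | Some m, Some n => (m <= n)%N
  end.

Lemma asbool_ex (P : nat -> Prop) (h : exists n, P n) : exists n, `[< P n >].
Proof. by case: h => n /asboolP Pn; exists n. Qed.

Definition natinf_min (P : nat -> Prop) : natinf :=
  if pselect (exists n, P n) is left h then Some (ex_minn (asbool_ex h))
  else None.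

Lemma natinf_min_le (P : nat -> Prop) (n : nat) :
  (forall i j, (i <= j)%N -> P i -> P j) ->
  natinf_le (natinf_min P) (Some n) <-> P n.
Proof.
move=> Pmono; rewrite /natinf_min.
case: pselect => [h|nP] /=; last by split=> // Pn; case: nP; exists n.
case: ex_minnP => m /asboolP Pm mmin; split=> [/Pmono|/asboolP/mmin//].
exact.
Qed.

Section QuotientModule.
Variables (R : nzRingType) (V : lmodType R) (W : submodClosed V).

(* W again, with the additive-subgroup structure required by {quot _}. *)
Definition submod_pred : {pred V} := fun x => x \in W.

Fact submod_pred_zmod : zmod_closed submod_pred.
Proof. exact: (GRing.submod_closedB (submodClosedP W)). Qed.

HB.instance Definition _ :=
  GRing.isZmodClosed.Build V submod_pred submod_pred_zmod.

Local Notation Q := (Quotient.quot submod_pred).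

Definition quot_mod : Type := Q.
HB.instance Definition _ := GRing.Zmodule.on quot_mod.

Definition quot_scale (a : R) (x : quot_mod) : quot_mod :=
  \pi_Q (a *: repr (x : Q)).

Lemma quot_scale_pi (a : R) (v : V) :
  quot_scale a (\pi_Q v) = \pi_Q (a *: v).
Proof.
apply/eqP; rewrite /quot_scale -Quotient.idealrBE -scalerBr.
have /(rpredZ a) : repr (\pi_Q v) - v \in W; last by [].
by have := Quotient.idealrBE submod_pred (repr (\pi_Q v)) v; rewrite reprK eqxx.
Qed.

Lemma quot_scaleA (a b : R) (x : quot_mod) :
  quot_scale a (quot_scale b x) = quot_scale (a * b) x.
Proof. by rewrite -[x](@reprK _ Q) !quot_scale_pi scalerA. Qed.

Lemma quot_scale1 : left_id 1 quot_scale.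
Proof. by move=> x; rewrite -[x](@reprK _ Q) quot_scale_pi scale1r. Qed.

Lemma quot_scaleDr : right_distributive quot_scale +%R.
Proof.
move=> a x y; rewrite -[x](@reprK _ Q) -[y](@reprK _ Q) !quot_scale_pi.
have piD u v : \pi_Q (u + v) = (\pi_Q u + \pi_Q v : quot_mod).
  exact: (raddfD (\pi_Q)).
by rewrite -!piD quot_scale_pi scalerDr.
Qed.

Lemma quot_scaleDl (x : quot_mod) :
  {morph quot_scale^~ x : a b / a + b}.
Proof.
move=> a b; rewrite -[x](@reprK _ Q) !quot_scale_pi scalerDl.
exact: (raddfD (\pi_Q)).
Qed.

HB.instance Definition _ := GRing.Zmodule_isLmodule.Build R quot_mod
  quot_scaleA quot_scale1 quot_scaleDr quot_scaleDl.

End QuotientModule.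

Section Ideals.
Variable R : comNzRingType.
Implicit Types (S : R -> Prop) (I : {pred R}).

(* Ideals of R are submodules of the regular module R^o. *)
Definition ideal_gen S : {pred R^o} := fun x =>
  `[< exists2 s : seq (R * R), (forall c, c \in s -> S c.2) &
      x = \sum_(c <- s) c.1 * c.2 >].

Lemma ideal_gen_submod S : submod_closed (ideal_gen S).
Proof.
split=> [|a x y /asboolP[s sS ->] /asboolP[s' s'S ->]]; apply/asboolP.
  by exists [::] => //; rewrite big_nil.
exists ([seq (a * c.1, c.2) | c <- s] ++ s') => [c|].
  by rewrite mem_cat => /orP[/mapP[d /sS Sd ->]|/s'S].
rewrite big_cat big_map /= /GRing.scale /= mulr_sumr.
by congr (_ + _); apply: eq_bigr => c _; rewrite mulrA.
Qed.

HB.instance Definition _ S :=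
  GRing.isSubmodClosed.Build R R^o (ideal_gen S)
    (GRing.submod_closed_semi (ideal_gen_submod S)).

Definition radical I : {pred R} := fun x => `[< exists m : nat, x ^+ m \in I >].

Definition ara I : natinf :=
  natinf_min (fun s => exists f : s.-tuple R,
    radical I =i radical (ideal_gen (fun x => x \in f))).

End Ideals.

Section ProjectiveDimension.
Variable R : nzRingType.

Definition surj (A B : Type) (f : A -> B) : Prop := forall y, exists x, f x = y.

Definition exact_at (A B C : lmodType R) (f : A -> B) (g : B -> C) : Prop :=
  forall y, g y = 0 <-> exists x, f x = y.

Definition projective (P : lmodType R) : Prop :=
  forall (M N : lmodType R) (f : {linear M -> N}) (g : {linear P -> N}),
    surj f -> exists h : {linear P -> M}, forall x, f (h x) = g x.

(* M has a projective resolution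
     ... -> P 1 -> P 0 -> M -> 0   with P i = 0 for all i > l. *)
Definition has_proj_resolution (M : lmodType R) (l : nat) : Prop :=
  exists (P : nat -> lmodType R) (d : forall i, {linear P i.+1 -> P i})
         (eps : {linear P 0%N -> M}),
    [/\ forall i, projective (P i),
        surj eps,
        exact_at (d 0%N) eps,
        forall i, exact_at (d i.+1) (d i)
      & forall i, (l < i)%N -> forall x : P i, x = 0].

Definition proj_dim (M : lmodType R) : natinf :=
  natinf_min (has_proj_resolution M).

End ProjectiveDimension.

Section RootedTrees.
Variable V : finType.

(* p lists the vertices after x of a path from x to y without repetition. *)
Definition joins (e : rel V) (x y : V) (p : seq V) : bool :=
  [&& path e x p, uniq (x :: p) & last x p == y].

Record rooted_tree := RootedTree {
  edge : rel V;
  root : V;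
  edge_sym : ssrbool.symmetric edge;
  edge_irr : irreflexive edge;
  edge_uniq_path : forall x y, x != y -> exists! p, joins edge x y p
}.

Variable T : rooted_tree.

Lemma tree_path_ex (x : V) : exists p, joins (edge T) (root T) x p.
Proof.
have [<-|/edge_uniq_path-/(_ T)[p [jp _]]] := eqVneq (root T) x.
  by exists [::]; rewrite /joins /= eqxx.
by exists p.
Qed.

Definition root_path (x : V) : seq V := xchoose (tree_path_ex x).

(* root_path omits the root, so its size is the number of vertices on the
   path minus one. *)
Definition level (x : V) : nat := size (root_path x).

Definition height : nat := \max_(x : V) level x.

Definition dedge : rel V := fun x y => edge T x y && (level x < level y)%N.

End RootedTrees.

Definition line_graph (n : nat) : rel 'I_n := fun i j => j == i.+1 :> nat.

Section PathIdeals.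
Variables (k : fieldType) (V : finType).

Local Notation R := {mpoly k[#|V|]}.

Definition vertex_var (v : V) : R := 'X_(enum_rank v).

(* The length t of a path counts its vertices. *)
Definition path_monomial (d : rel V) (t : nat) (m : R) : Prop :=
  exists2 p : t.-tuple V, sorted d p & m = \prod_(v <- p) vertex_var v.

Definition path_ideal (d : rel V) (t : nat) : submodClosed R^o :=
  ideal_gen (path_monomial d t).

End PathIdeals.

(* Main.v *)
(* Let I be the path ideal of the tree and let h be the largest cardinality of a
   minimal vertex cover of its generating paths, that is, the
   largest height of a minimal prime of I. The second inequality is
   pd(R/I) <= h <= ara(I).
   - pd(R/I) <= h: two directed paths through a vertex v have nested sets of
     predecessors of v, and families of sets with this property have a member e
     with a vertex b such that every member through b contains e. Induction on
     the family along 0 -> R/(I : m) -> R/I -> R/(I + (m)) -> 0, where m is the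
     product of the variables of e other than b, bounds pd(R/I).
   - h <= ara(I): setting the variables outside a minimal cover Q to 1 turns
     generators of I up to radical into polynomials without constant term whose
     ideal contains a power of each variable of Q; counting monomials, at least
     #|Q| such polynomials are needed.
   For the first inequality, L_n is the path from the root to a vertex of maximal
   level. Inclusion of its variables and killing the other variables make
   R'/I_t(L_n) a retract of R/I_t(Gamma) over the polynomial ring R' of L_n, and
   projective R-modules are projective over R'. *)

Require Import Defs.
From HB Require Import structures.
From mathcomp Require Import all_boot all_algebra.
From mathcomp Require Import boolp.
From mathcomp.multinomials Require Import ssrcomplements mpoly.

Set Implicit Arguments.
Unset Strict Implicit.
Unset Printing Implicit Defensive.

Import GRing.Theory.

Local Open Scope ring_scope.
Local Open Scope quotient_scope.

(** * Modules and projective dimension *)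

Section LinearMaps.
Variable R : nzRingType.
Implicit Types A B C M N P Q : lmodType R.

Definition mk_linear A B (f : A -> B) (lf : linear f) : {linear A -> B} :=
  HB.pack f (GRing.isLinear.Build R A B *:%R f lf).

Definition zero_mod : lmodType R := 'rV[R]_0.

Lemma zero_modE (x : zero_mod) : x = 0.
Proof. exact: thinmx0. Qed.

Section Kernel.
Variables (A B : lmodType R) (f : {linear A -> B}).

Definition ker_pred : {pred A} := fun x => f x == 0.

Fact ker_pred_submod : submod_closed ker_pred.
Proof.
split=> [|a x y]; rewrite !unfold_in ?linear0 // linearP => /eqP-> /eqP->.
by rewrite scaler0 addr0.
Qed.

HB.instance Definition _ :=
  GRing.isSubmodClosed.Build R A ker_pred
    (GRing.submod_closed_semi ker_pred_submod).

Definition ker_mod : Type := {x : A | x \in ker_pred}.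
HB.instance Definition _ := SubChoice.on ker_mod.
HB.instance Definition _ := [SubChoice_isSubLmodule of ker_mod by <:].

(** Locked so that simplification does not unfold the inclusion. *)
Definition ker_val : {linear ker_mod -> A} :=
  locked (\val : {linear ker_mod -> A}).

Lemma ker_val_val x : ker_val x = \val x.
Proof. by rewrite /ker_val -lock. Qed.

Lemma ker_val_inj : injective ker_val.
Proof. by move=> x y; rewrite !ker_val_val; apply: val_inj. Qed.

Lemma ker_valP (x : ker_mod) : f (ker_val x) = 0.
Proof. by rewrite ker_val_val; apply/eqP/(valP x). Qed.

Lemma ker_valE (x : A) : f x = 0 -> exists y, ker_val y = x.
Proof.
move=> fx; have h : x \in ker_pred by apply/eqP.
by exists (Sub x h); rewrite ker_val_val.
Qed.

End Kernel.

Definition short_exact A B C (f : {linear A -> B}) (g : {linear B -> C}) :=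
  [/\ injective f, surj g & exact_at f g].

Lemma short_exact_ker A B (f : {linear A -> B}) :
  surj f -> short_exact (ker_val f) f.
Proof.
move=> sf; split=> //; first exact: ker_val_inj.
by move=> x; split=> [/ker_valE//|[y <-]]; apply: ker_valP.
Qed.



(** Preimages under an injective map are unique, so the chosen ones depend linearly on the
    argument. *)
Lemma lift_injective A B C (f : {linear A -> B}) (u : {linear C -> B}) :
  injective f -> (forall x, exists y, f y = u x) ->
  exists v : {linear C -> A}, forall x, f (v x) = u x.
Proof.
move=> fI /choice[v fv].
have lin : linear v by move=> a x y; apply: fI; rewrite linearP /= !fv linearP.
by exists (mk_linear lin).
Qed.

Lemma ker_lift A B C (f : {linear A -> B}) (g : {linear C -> A}) :
  (forall x, f (g x) = 0) ->
  exists h : {linear C -> ker_mod f}, forall x, ker_val f (h x) = g x.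
Proof.
by move=> fg; apply: lift_injective (@ker_val_inj _ _ f) _ => x; apply: ker_valE.
Qed.

Lemma pair_linear A B C (f : {linear C -> A}) (g : {linear C -> B}) :
  linear (fun x => (f x, g x) : (A * B)%type).
Proof. by move=> a x y; rewrite !linearP. Qed.

Lemma copair_linear A B C (f : {linear A -> C}) (g : {linear B -> C}) :
  linear (fun x : (A * B)%type => f x.1 + g x.2).
Proof. by move=> a x y; rewrite !linearP /= scalerDr addrACA. Qed.

Definition pairm A B C (f : {linear C -> A}) (g : {linear C -> B}) :=
  mk_linear (pair_linear f g).

Definition copairm A B C (f : {linear A -> C}) (g : {linear B -> C}) :=
  mk_linear (copair_linear f g).

Definition zerom A B : {linear A -> B} := \0.

Definition idm A : {linear A -> A} := idfun.

Lemma projective_zero P : (forall x : P, x = 0) -> projective P.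
Proof.
by move=> P0 M N f g _; exists (zerom P M) => x; rewrite (P0 x) !linear0.
Qed.

Lemma projective_regular : projective R^o.
Proof.
move=> M N f g sf; have [m fm] := sf (g 1).
have lin : linear (fun a : R^o => (a : R) *: m).
  by move=> a x y; rewrite scalerDl scalerA.
exists (mk_linear lin) => x /=.
by rewrite linearZ /= fm -linearZ /= [_ *: _]mulr1.
Qed.

Lemma projective_retract P Q (i : {linear Q -> P}) (r : {linear P -> Q}) :
  cancel i r -> projective P -> projective Q.
Proof.
move=> ir pP M N f g sf.
have [h fh] := pP M N f (g \o r) sf.
by exists (h \o i) => x /=; rewrite fh /= ir.
Qed.

Lemma projective_prod P Q : projective P -> projective Q ->
  projective (P * Q)%type.
Proof.
move=> pP pQ M N f g sf.
have [h1 fh1] := pP M N f (g \o pairm (idm P) (zerom P Q)) sf.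
have [h2 fh2] := pQ M N f (g \o pairm (zerom Q P) (idm Q)) sf.
exists (copairm h1 h2) => -[x y] /=.
rewrite linearD fh1 fh2 /= -linearD; congr (g _).
by apply/pair_equal_spec => /=; rewrite addr0 add0r.
Qed.

End LinearMaps.

(** * Projective dimension through iterated syzygies *)

Section ProjectiveDimensionBounds.
Variable R : nzRingType.
Implicit Types A B C M N P Q : lmodType R.

(** Peeling off one syzygy at a time allows induction on [l]; [pd_le_resolution] and
    [resolution_pd_le] show the equivalence with resolutions of length [l]. *)
Fixpoint pd_le (l : nat) (M : lmodType R) : Prop :=
  if l is l'.+1 then
    exists (K P : lmodType R) (i : {linear K -> P}) (p : {linear P -> M}),
      [/\ short_exact i p, projective P & pd_le l' K]
  else projective M.

Lemma pd_leS l M : pd_le l M -> pd_le l.+1 M.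
Proof.
elim: l M => [M pM|l IH M [K [P [i [p [ip pP pK]]]]]].
  exists (zero_mod R), M, (zerom _ M), (idm M); split=> //.
    split=> [x y _|y|y /=]; first by rewrite (zero_modE x) [RHS]zero_modE.
      by exists y.
    by split=> [->|[x <-] //]; exists 0.
  by apply: projective_zero; apply: zero_modE.
by exists K, P, i, p; split=> //; apply: IH.
Qed.

Lemma pd_le_projective l M : projective M -> pd_le l M.
Proof. by move=> pM; elim: l => // l; apply: pd_leS. Qed.

(** Horseshoe lemma: [PA * PC] covers [B], with [PC] mapped by a lift [q] of [pC] through [g], and
    the kernel is an extension of [KC] by [KA]. For [l = 0] the sequence splits. *)
Lemma pd_le_extension l A B C (f : {linear A -> B}) (g : {linear B -> C}) :
  short_exact f g -> pd_le l A -> pd_le l C -> pd_le l B.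
Proof.
elim: l A B C f g => [|l IH] A B C f g [fI gS fg] /=.
  move=> pA pC; have [s gs] := pC _ _ g (idm C) gS.
  pose u : {linear B -> B} := idm B \- (s \o g).
  have [v fv] : exists v : {linear B -> A}, forall x, f (v x) = u x.
    by apply: lift_injective fI _ => x; apply/fg; rewrite /= linearB gs subrr.
  apply: (@projective_retract _ _ _ (pairm v g) (copairm f s)) => [x /=|].
    by rewrite fv /= subrK.
  exact: projective_prod.
move=> [KA [PA [iA [pA [[iAI pAS iApA] pPA pdA]]]]].
move=> [KC [PC [iC [pC [[iCI pCS iCpC] pPC pdC]]]]].
have [q gq] := pPC _ _ g pC gS.
pose p : {linear (PA * PC)%type -> B} := copairm (f \o pA) q.
have pS : surj p.
  move=> b; have [c pc] := pCS (g b).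
  have /fg[a' fa'] : g (b - q c) = 0 by rewrite linearB gq pc subrr.
  have [a pa] := pAS a'; exists (a, c).
  by rewrite /= pa fa' subrK.
exists (ker_mod p), (PA * PC)%type, (ker_val p), p; split.
- exact: short_exact_ker.
- exact: projective_prod.
have [f' f'E] : exists f' : {linear KA -> ker_mod p},
    forall x, ker_val p (f' x) = pairm iA (zerom _ PC) x.
  apply: ker_lift => x; have /iApA pi0 : exists y, iA y = iA x by exists x.
  by rewrite /= pi0 !linear0 addr0.
have [g' g'E] : exists g' : {linear ker_mod p -> KC},
    forall x, iC (g' x) = (snd \o ker_val p) x.
  apply: lift_injective => // x; apply/iCpC; rewrite /= -gq.
  have := ker_valP x; rewrite /= => /eqP; rewrite addrC addr_eq0 => /eqP->.
  rewrite linearN; apply/eqP; rewrite oppr_eq0; apply/eqP/fg; by eexists.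
apply: (IH _ _ _ f' g') => //; split.
- move=> x y /(congr1 (fst \o ker_val p)); rewrite /= !f'E /=; exact: iAI.
- move=> z; have /iCpC pz : exists x, iC x = iC z by exists z.
  have /fg[a' fa'] : g (q (iC z)) = 0 by rewrite gq.
  have [a pa] := pAS (- a').
  have [y yE] : exists y, ker_val p y = (a, iC z).
    by apply: ker_valE; rewrite /= pa linearN fa' addNr.
  by exists y; apply: iCI; rewrite g'E /= yE.
- move=> y; split=> [gy|[x <-]]; last by apply: iCI; rewrite g'E /= f'E linear0.
  have y2 : (ker_val p y).2 = 0 by rewrite -[LHS]g'E gy linear0.
  have /iApA[x xE] : pA (ker_val p y).1 = 0.
    by apply: fI; have := ker_valP y; rewrite /= y2 !linear0 addr0.
  exists x; apply: ker_val_inj; rewrite f'E /= xE.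
  by case: (ker_val p y) y2 => /= ? ? ->.
Qed.

(** With [K] the kernel of [p : P -> B], the kernel of [g \o p] is an extension of [A] by [K], and
    both have dimension at most [l]. *)
Lemma pd_le_cokernel l A B C (f : {linear A -> B}) (g : {linear B -> C}) :
  short_exact f g -> pd_le l A -> pd_le l.+1 B -> pd_le l.+1 C.
Proof.
move=> [fI gS fg] pdA [K [P [i [p [[iI pS ip] pP pdK]]]]].
have gpS : surj (g \o p).
  by move=> c; have [b <-] := gS c; have [x <-] := pS b; exists x.
exists (ker_mod (g \o p)), P, (ker_val (g \o p)), (g \o p).
split=> //; first exact: short_exact_ker.
have [i' i'E] : exists i' : {linear K -> ker_mod (g \o p)},
    forall x, ker_val (g \o p) (i' x) = i x.
  apply: ker_lift => x; have /ip pi0 : exists y, i y = i x by exists x.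
  by rewrite /= pi0 linear0.
have [p' p'E] : exists p' : {linear ker_mod (g \o p) -> A},
    forall x, f (p' x) = (p \o ker_val (g \o p)) x.
  apply: lift_injective => // x; apply/fg; exact: (ker_valP x).
apply: (pd_le_extension (f := i') (g := p')) pdK pdA; split.
- by move=> x y /(congr1 (ker_val (g \o p))); rewrite !i'E; apply: iI.
- move=> a; have [x px] := pS (f a).
  have [y yE] : exists y, ker_val (g \o p) y = x.
    by apply: ker_valE; rewrite /= px; apply/fg; exists a.
  by exists y; apply: fI; rewrite p'E /= yE px.
- move=> y; split=> [py|[x <-]].
    have /ip[x xE] : p (ker_val (g \o p) y) = 0 by rewrite -[LHS]p'E py linear0.
    by exists x; apply: ker_val_inj; rewrite i'E xE.
  apply: fI; rewrite p'E /= i'E linear0; apply/ip; by eexists.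
Qed.

Lemma pd_le_retract l M N (i : {linear N -> M}) (r : {linear M -> N}) :
  cancel i r -> pd_le l M -> pd_le l N.
Proof.
elim: l M N i r => [|l IH] M N i r ir /=; first exact: projective_retract ir.
move=> [K [P [k [p [[kI pS kp] pP pdK]]]]].
have rpS : surj (r \o p).
  by move=> y; have [x xE] := pS (i y); exists x; rewrite /= xE ir.
exists (ker_mod (r \o p)), P, (ker_val (r \o p)), (r \o p).
split=> //; first exact: short_exact_ker.
(* [h] lifts the idempotent [i \o r] to [P]; then [x |-> (h x, x)] embeds the
   kernel of [r \o p] into [K * P], with retraction [(x, y) |-> y - h y + x]. *)
have [h ph] := pP _ _ p (i \o (r \o p)) pS.
have [v vE] : exists v : {linear ker_mod (r \o p) -> K},
    forall x, k (v x) = (h \o ker_val (r \o p)) x.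
  by apply: lift_injective => // x; apply/kp;
     rewrite /= ph /=; have /= -> := ker_valP x; rewrite linear0.
pose w : {linear (K * P)%type -> P} := copairm k (idm P \- h).
have [s sE] : exists s : {linear (K * P)%type -> ker_mod (r \o p)},
    forall x, ker_val (r \o p) (s x) = w x.
  apply: ker_lift => x.
  have /kp pk0 : exists y, k y = k x.1 by exists x.1.
  by rewrite /= linearD pk0 add0r !linearB ph /= ir subrr.
apply: (IH _ _ (pairm v (ker_val (r \o p))) s) => [x|].
  by apply: ker_val_inj; rewrite sE /= vE /= addrC subrK.
have pdP := pd_le_projective l pP.
apply: (pd_le_extension (f := pairm (idm K) (zerom K P)) (g := snd)) pdK pdP.
split=> [x y [] // |y|[x y] /=]; first by exists (0, y).
by split=> [->|[z [_ <-]] //]; exists x.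
Qed.

(** The resolution of the syzygy [K] is spliced onto [P] along [i \o eps]. *)
Lemma pd_le_resolution l M : pd_le l M -> has_proj_resolution M l.
Proof.
elim: l M => [M pM|l IH M [K [P [i [p [[iI pS ip] pP /IH]]]]]].
  exists (fun n => if n is 0 then M else zero_mod R).
  exists (fun n => zerom _ _), (idm M); split=> //.
  - by case=> // n; apply: projective_zero; apply: zero_modE.
  - by move=> y; exists y.
  - by move=> y; split=> [/= ->|[x <-]//]; exists 0.
  - by move=> n y; split=> // _; exists 0; rewrite [RHS]zero_modE.
  - by case=> // n _ x; apply: zero_modE.
move=> [Q [d [eps [pQ epsS deps dd Q0]]]].
pose S : nat -> lmodType R := fun n => if n is n'.+1 then Q n' else P.
pose D : forall n, {linear S n.+1 -> S n} := fun n =>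
  match n with 0%N => i \o eps | n'.+1 => d n' end.
exists S, D.
exists p; split=> //.
- by case.
- move=> y; split=> [/ip[x <-]|[x <-]]; last by apply/ip; eexists.
  by have [z <-] := epsS x; exists z.
- case=> [|n]; last exact: dd.
  move=> y; rewrite -deps; change (i (eps y) = 0 <-> eps y = 0).
  split=> [|->]; last by rewrite linear0.
  by rewrite -[X in _ = X -> _](linear0 i) => /iI.
- by case.
Qed.

(** The kernel of [eps] is resolved by the same complex shifted by one. For [l = 0], [eps] is an
    isomorphism because [P 1] is zero. *)
Lemma resolution_pd_le l M : has_proj_resolution M l -> pd_le l M.
Proof.
elim: l M => [|l IH] M [P [d [eps [pP epsS deps dd P0]]]].
  have epsI : injective eps.
    move=> x y /eqP; rewrite -subr_eq0 -linearB => /eqP/deps[z zE].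
    by apply/eqP; rewrite -subr_eq0 -zE (P0 1%N isT z) linear0.
  have [h hE] : exists h : {linear M -> P 0%N}, forall x, eps (h x) = idm M x.
    by apply: lift_injective => // x; apply: epsS.
  by apply: (projective_retract hE) (pP 0%N).
exists (ker_mod eps), (P 0%N), (ker_val eps), eps; split=> //.
  exact: short_exact_ker.
have [e eE] : exists e : {linear P 1%N -> ker_mod eps},
    forall x, ker_val eps (e x) = d 0%N x.
  by apply: ker_lift => x; apply/deps; exists x.
apply: IH; exists (fun n => P n.+1), (fun n => d n.+1), e; split=> //.
- move=> y; have /deps[x xE] := ker_valP y.
  by exists x; apply: ker_val_inj; rewrite eE.
- move=> y; rewrite -dd -eE; split=> [->|]; first by rewrite linear0.
  by rewrite -[X in _ = X -> _](linear0 (ker_val eps)) => /ker_val_inj.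
- by move=> n ln x; apply: P0.
Qed.

End ProjectiveDimensionBounds.

(** * Quotient modules *)

Section Quotients.
Variables (R : nzRingType) (V : lmodType R).
Implicit Types (W : submodClosed V) (N : lmodType R).

Lemma quot_proj_linear W :
  linear (fun x => \pi_(Quotient.quot (submod_pred W)) x : quot_mod W).
Proof.
move=> a x y; have /= E := quot_scale_pi W a x; rewrite [X in _ = X + _]E.
exact: (raddfD (\pi_(Quotient.quot (submod_pred W)))).
Qed.

Definition quot_proj W : {linear V -> quot_mod W} :=
  locked (mk_linear (@quot_proj_linear W)).

Lemma quot_projE W x :
  quot_proj W x = \pi_(Quotient.quot (submod_pred W)) x.
Proof. by rewrite /quot_proj -lock. Qed.

Lemma quot_proj_surj W : surj (quot_proj W).
Proof.
move=> y; exists (repr (y : Quotient.quot (submod_pred W))).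
by rewrite quot_projE reprK.
Qed.

Lemma quot_proj_eq0 W x : quot_proj W x = 0 <-> x \in W.
Proof.
have E : (x \in W) = (quot_proj W x == quot_proj W 0).
  by rewrite !quot_projE -Quotient.idealrBE subr0.
by rewrite E linear0; split=> [->|/eqP].
Qed.

Lemma quot_lift W N (f : {linear V -> N}) : (forall x, x \in W -> f x = 0) ->
  exists g : {linear quot_mod W -> N}, forall x, g (quot_proj W x) = f x.
Proof.
move=> fW; have [s sE] := choice (@quot_proj_surj W).
have fs x : f (s (quot_proj W x)) = f x.
  apply/eqP; rewrite -subr_eq0 -linearB; apply/eqP/fW/quot_proj_eq0.
  by rewrite linearB sE subrr.
have lin : linear (f \o s).
  by move=> a x y; rewrite /= -{1}[x]sE -{1}[y]sE -!linearP /= fs linearP.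
by exists (mk_linear lin).
Qed.

(** The maps are induced by [u] and by the identity. For [u] the multiplication by a monomial, [W1]
    is the colon ideal and [W3] the sum with the principal ideal. *)
Lemma quot_short_exact (u : {linear V -> V}) W1 W2 W3 :
  (forall x, x \in W1 <-> u x \in W2) ->
  (forall x, x \in W3 <-> exists r, x - u r \in W2) ->
  exists (f : {linear quot_mod W1 -> quot_mod W2})
         (g : {linear quot_mod W2 -> quot_mod W3}), short_exact f g.
Proof.
move=> W1E W3E.
have [f fE] : exists f : {linear quot_mod W1 -> quot_mod W2},
    forall x, f (quot_proj W1 x) = (quot_proj W2 \o u) x.
  by apply: quot_lift => x /W1E xW; apply/quot_proj_eq0.
have [g gE] : exists g : {linear quot_mod W2 -> quot_mod W3},
    forall x, g (quot_proj W2 x) = quot_proj W3 x.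
  apply: quot_lift => x xW; apply/quot_proj_eq0/W3E.
  by exists 0; rewrite linear0 subr0.
exists f, g; split.
- move=> x y /eqP; rewrite -subr_eq0 -linearB => /eqP.
  have [z zE] := quot_proj_surj (x - y).
  rewrite -zE fE => /quot_proj_eq0/W1E/quot_proj_eq0; rewrite zE => /eqP.
  by rewrite subr_eq0 => /eqP.
- by move=> y; have [z <-] := quot_proj_surj y; exists (quot_proj W2 z).
- move=> y; have [z <-] := quot_proj_surj y; rewrite gE; split.
    move=> /quot_proj_eq0/W3E[r /quot_proj_eq0]; rewrite linearB => /eqP.
    by rewrite subr_eq0 => /eqP zr; exists (quot_proj W1 r); rewrite fE.
  move=> [x]; have [r <-] := quot_proj_surj x; rewrite fE => /eqP.
  rewrite eq_sym -subr_eq0 -linearB => /eqP/quot_proj_eq0 zr.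
  by apply/quot_proj_eq0/W3E; exists r.
Qed.

Lemma pd_le_quot_eq l W1 W2 : W1 =i W2 ->
  pd_le l (quot_mod W1) -> pd_le l (quot_mod W2).
Proof.
move=> eW.
have [f fE] : exists f : {linear quot_mod W2 -> quot_mod W1},
    forall x, f (quot_proj W2 x) = quot_proj W1 x.
  by apply: quot_lift => x; rewrite -eW => /quot_proj_eq0.
have [g gE] : exists g : {linear quot_mod W1 -> quot_mod W2},
    forall x, g (quot_proj W1 x) = quot_proj W2 x.
  by apply: quot_lift => x; rewrite eW => /quot_proj_eq0.
apply: (pd_le_retract (i := f) (r := g)) => y.
by have [z <-] := quot_proj_surj y; rewrite fE gE.
Qed.

Lemma pd_le_quot_full l W : (forall x, x \in W) -> pd_le l (quot_mod W).
Proof.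
move=> WT; apply/pd_le_projective/projective_zero => y.
by have [z <-] := quot_proj_surj y; apply/quot_proj_eq0.
Qed.

Lemma pd_le_quot_trivial l W : (forall x, x \in W -> x = 0) -> projective V ->
  pd_le l (quot_mod W).
Proof.
move=> W0 pV; apply: pd_le_projective.
have [f fE] : exists f : {linear quot_mod W -> V},
    forall x, f (quot_proj W x) = idm V x.
  by apply: quot_lift => x /W0.
apply: (projective_retract (i := f) (r := quot_proj W)) pV => y.
by have [z <-] := quot_proj_surj y; rewrite fE.
Qed.

End Quotients.

(** * Squarefree monomial ideals *)

Section MonomialIdeals.
Variables (k : fieldType) (N : nat).
Local Notation R := {mpoly k[N]}.
Implicit Types (E : seq {set 'I_N}) (S : {set 'I_N}) (a : 'X_{1..N}).

Definition mnm_supp a : {set 'I_N} := [set i | a i != 0%N].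

(** Membership of the monomial with exponent [a] in the ideal of [E]; see [edge_idealX]. *)
Definition dominates E a := has (fun e : {set _} => e \subset mnm_supp a) E.

Definition mnm_set S : 'X_{1..N} := [multinom (i \in S : nat) | i < N].

Lemma mnm_suppD a b : mnm_supp (a + b)%MM = mnm_supp a :|: mnm_supp b.
Proof. by apply/setP => i; rewrite !inE mnmDE addn_eq0 negb_and. Qed.

Lemma mnm_supp_set S : mnm_supp (mnm_set S) = S.
Proof. by apply/setP => i; rewrite !inE mnmE eqb0 negbK. Qed.

Lemma mnm_set_le S a : (mnm_set S <= a)%MM = (S \subset mnm_supp a).
Proof.
apply/mnm_lepP/subsetP => [le_a i iS|sub i].
  by have := le_a i; rewrite mnmE iS inE -lt0n.
by rewrite mnmE; have [/sub|//] := boolP (i \in S); rewrite inE lt0n.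
Qed.

Lemma dominatesDr E a b : dominates E b -> dominates E (a + b)%MM.
Proof.
move=> /hasP[e eE eb]; apply/hasP; exists e => //.
by rewrite mnm_suppD subsetU // eb orbT.
Qed.

(* The squarefree monomial ideal generated by the products of the variables
   in the members of [E]. *)
Definition edge_pred E : {pred R^o} := fun p : R => all (dominates E) (msupp p).

Lemma edge_pred_submod E : submod_closed (edge_pred E).
Proof.
split=> [|c x y /allP xE /allP yE]; first by rewrite unfold_in msupp0.
apply/allP => a /msuppD_le; rewrite mem_cat => /orP[|/yE //].
by move=> /msuppM_le/allpairsP[[m1 m2] /= [_ /xE m2E ->]]; apply: dominatesDr.
Qed.

HB.instance Definition _ E :=
  GRing.isSubmodClosed.Build R R^o (edge_pred E)
    (GRing.submod_closed_semi (edge_pred_submod E)).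

Definition edge_ideal E : submodClosed R^o := edge_pred E.

Lemma edge_idealX E a : (('X_[a] : R) \in edge_ideal E) = dominates E a.
Proof. by rewrite [LHS]unfold_in msuppX /= andbT. Qed.

Lemma mul_linear (r : R) : linear ((fun x => x * r) : R^o -> R^o).
Proof. by move=> a x y; rewrite mulrDl -mulrA. Qed.

Definition mulm (r : R) : {linear R^o -> R^o} := mk_linear (mul_linear r).

Lemma edge_ideal_colon E E' m :
  (forall a, dominates E' a = dominates E (m + a)) ->
  forall x : R^o, x \in edge_ideal E' <-> mulm 'X_[m] x \in edge_ideal E.
Proof.
move=> EE' x; split=> /allP xE; apply/allP => a.
  by rewrite (perm_mem (msuppMX _ _)) => /mapP[b /xE bE' ->]; rewrite -EE'.
move=> ax; rewrite EE'; apply: xE.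
by rewrite (perm_mem (msuppMX _ _)); apply: map_f.
Qed.

Lemma edge_ideal_add E E' m :
  (forall a, dominates E' a = dominates E a || (m <= a)%MM) ->
  forall x : R^o, x \in edge_ideal E' <->
    exists r, x - mulm 'X_[m] r \in edge_ideal E.
Proof.
move=> EE' x; split=> [/allP xE|[r xrE]]; last first.
  rewrite -(subrK (mulm 'X_[m] r) x) rpredD //.
    by apply/allP => a /(allP xrE); rewrite EE' => ->.
  apply: (@rpredZ _ _ (edge_ideal E') r).
  by rewrite edge_idealX EE' lepm_refl orbT.
(* The terms of [x] divisible by the monomial of [m], divided by it; the terms left over are
   dominated by [E]. *)
exists (\sum_(a <- msupp (x : R) | (m <= a)%MM) (x : R)@_a *: 'X_[a - m]).
rewrite /= mulr_suml [X in X - _](mpolyE (x : R)).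
rewrite (bigID (fun a => (m <= a)%MM)) /= addrAC -sumrB big1 ?add0r; last first.
  move=> a ma; apply/eqP; rewrite subr_eq0; apply/eqP.
  have := scalerAl (x : R)@_a ('X_[a - m] : R) 'X_[m].
  by rewrite -mpolyXD submK.
rewrite big_seq_cond; apply: rpred_sum => a /andP[/xE aE' ma].
rewrite -mul_mpolyC; apply: (@rpredZ _ _ (edge_ideal E)).
by rewrite edge_idealX; move: aE'; rewrite EE' (negPf ma) orbF.
Qed.

Lemma edge_ideal_short_exact E E1 E2 S :
  (forall a, dominates E1 a = dominates E (mnm_set S + a)) ->
  (forall a, dominates E2 a = dominates E a || (S \subset mnm_supp a)) ->
  exists (f : {linear quot_mod (edge_ideal E1) -> quot_mod (edge_ideal E)})
         (g : {linear quot_mod (edge_ideal E) -> quot_mod (edge_ideal E2)}),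
    short_exact f g.
Proof.
move=> E1E E2E; apply: (quot_short_exact (u := mulm 'X_[mnm_set S])).
  exact: edge_ideal_colon.
by apply: edge_ideal_add => a; rewrite E2E mnm_set_le.
Qed.

End MonomialIdeals.

(** * Minimal vertex covers *)

Section Covers.
Variable T : finType.
Implicit Types (E : seq {set T}) (Q e f S : {set T}).

(** Minimality is expressed by a private member for each [q], the form in which [dehomog_edge] needs
    it. *)
Definition min_cover E Q :=
  (forall e, e \in E -> exists2 q, q \in Q & q \in e) /\
  (forall q, q \in Q -> exists2 e, e \in E & Q :&: e = [set q]).

(** Take an inclusion-minimal cover: a member left uncovered after deleting [q] meets the cover in
    [q] only. *)
Lemma min_cover_ex E Q : (forall e, e \in E -> exists2 q, q \in Q & q \in e) ->
  exists2 Q' : {set T}, Q' \subset Q & min_cover E Q'.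
Proof.
pose cov Q := all (fun e => Q :&: e != set0) E.
have covP Q' : reflect (forall e, e \in E -> exists2 q, q \in Q' & q \in e)
    (cov Q').
  apply: (iffP allP) => h e /h; last first.
    by move=> [q qQ qe]; apply/set0Pn; exists q; rewrite inE qQ.
  by move=> /set0Pn[q]; rewrite inE => /andP[]; exists q.
move=> /covP covQ; have [Q' minQ' Q'Q] := minset_exists covQ.
have [covQ' minQ] := minsetP minQ'; exists Q' => //; split; first exact/covP.
move=> q qQ'; have : ~~ cov (Q' :\ q).
  apply: contraTN qQ' => /minQ/(_ (subsetDl _ _)) <-; by rewrite !inE eqxx.
move=> /allPn[e eE]; rewrite negbK => /eqP e0; exists e => //.
have /allP/(_ e eE)/set0Pn[x] := covQ'.
have qx y : y \in Q' :&: e -> y = q.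
  move=> yQ; apply/eqP; apply: contraT => ny.
  by move: yQ; rewrite -{1}(setD1K qQ') setIUl e0 setU0 !inE (negPf ny).
move=> xQ; apply/setP => y; rewrite inE; apply/idP/eqP => [/qx //|->].
by rewrite -(qx x xQ).
Qed.

End Covers.

(** * Nested families of sets *)

Section NestedFamilies.
Local Open Scope nat_scope.
Variables (T : finType) (lam : T -> nat).
Implicit Types (E : seq {set T}) (Q e f S : {set T}).

Definition below v e : {set T} := [set u in e | lam u <= lam v].

(** For directed paths in a tree, with [lam] the level, the sets compared are the initial segments
    ending at [v]. *)
Definition nested E := forall e f v, e \in E -> f \in E -> v \in e -> v \in f ->
  (below v e \subset below v f) || (below v f \subset below v e).

Lemma belowD v e S : below v (e :\: S) = below v e :\: S.
Proof. by apply/setP => u; rewrite !inE andbA. Qed.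

Lemma nested_sub E E' : {subset E' <= E} -> nested E -> nested E'.
Proof. by move=> sub nE e f v /sub eE /sub fE; apply: nE. Qed.

Lemma nested_setD E S : nested E -> nested [seq f :\: S | f <- E].
Proof.
move=> nE _ _ v /mapP[e eE ->] /mapP[f fE ->]; rewrite !inE.
move=> /andP[_ ve] /andP[_ vf]; rewrite !belowD.
by case/orP: (nE e f v eE fE ve vf) => sub; rewrite (setSD _ sub) ?orbT.
Qed.

(** Only comparisons with [e :\ b] are new. A member through [b] contains [e]; for a member avoiding
    [b], its comparison with [e] survives the deletion of [b]. *)
Lemma nested_shrink E e b : nested E -> e \in E ->
  (forall f, f \in E -> b \in f -> e \subset f) ->
  nested (e :\ b :: [seq f <- E | f != e]).
Proof.
move=> nE eE eb.
have nb f v : f \in E -> v \in e :\ b -> v \in f ->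
  (below v (e :\ b) \subset below v f) || (below v f \subset below v (e :\ b)).
  move=> fE; rewrite !inE belowD => /andP[_ ve] vf.
  have [bf|bf] := boolP (b \in f).
    rewrite (subset_trans (subsetDl _ _)) //; apply/subsetP => u.
    by rewrite !inE => /andP[/(subsetP (eb f fE bf))-> ->].
  have [sub|sub] := orP (nE e f v eE fE ve vf).
    by rewrite (subset_trans (subsetDl _ _)).
  apply/orP; right; rewrite subsetD1 sub !inE.
  by rewrite (negPf bf).
move=> f g v; rewrite !inE !mem_filter.
move=> /predU1P[->|/andP[_ fE]] /predU1P[->|/andP[_ gE]] vf vg.
- by rewrite subxx.
- exact: nb.
- by rewrite orbC; apply: nb.
- exact: nE.
Qed.

(** The sum of the cardinalities is the induction measure in [pd_le_edge_ideal]; this lemma and the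
    next make it decrease. *)
Lemma sum_card_filter E (P : pred {set T}) e : e \in E -> ~~ P e ->
  \sum_(f <- [seq f <- E | P f]) #|f| + #|e| <= \sum_(f <- E) #|f|.
Proof.
move=> eE nPe; rewrite big_filter !(perm_big _ (perm_to_rem eE)) !big_cons.
rewrite (negPf nPe) addnC leq_add2l big_mkcond.
by apply: leq_sum => f _; case: ifP.
Qed.

Lemma sum_card_setD E S e : e \in E -> ~~ [disjoint e & S] ->
  \sum_(f <- [seq f :\: S | f <- E]) #|f| < \sum_(f <- E) #|f|.
Proof.
move=> eE eS; rewrite big_map !(perm_big _ (perm_to_rem eE)) !big_cons.
rewrite -addSn leq_add //; last first.
  by apply: leq_sum => f _; apply/subset_leq_card/subsetDl.
by rewrite -[X in _ < X](cardsID S) -add1n leq_add2r card_gt0 setI_eq0.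
Qed.

(** Each element of [Q] lies in some [f :\: S], so [Q] avoids [S], and restoring [S] does not change
    the traces of the members on [Q]. *)
Lemma min_cover_colon E S Q : min_cover [seq f :\: S | f <- E] Q -> min_cover E Q.
Proof.
move=> [cov priv]; split=> [f fE|q qQ].
  have [|q qQ] := cov (f :\: S); first exact: map_f.
  by rewrite inE => /andP[_ qf]; exists q.
have [_ /mapP[f fE ->] Qf] := priv q qQ; exists f => //.
rewrite -Qf setIDA; apply/esym/setDidPl; rewrite disjoint_sym.
apply/pred0P => x /=; rewrite inE; apply/negP => /and3P[xS xQ _].
have [_ /mapP[g _ ->] Qg] := priv x xQ.
by have := set11 x; rewrite -Qg !inE xS andbF.
Qed.

(** The point is that [b] is not in [Q]: its private member would pass through [b], hence contain
    [e] and with it the element [q0] of [Q] that covers [e :\ b]. *)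
Lemma min_cover_shrink E e b Q : e \in E ->
  (forall f, f \in E -> b \in f -> e \subset f) ->
  min_cover (e :\ b :: [seq f <- E | f != e]) Q -> min_cover E Q.
Proof.
move=> eE eb [cov priv].
have [q0 q0Q] := cov _ (mem_head _ _); rewrite !inE => /andP[q0b q0e].
have bQ : b \notin Q.
  apply/negP => bQ; have [f] := priv b bQ; rewrite inE mem_filter => fE Qf.
  have bf : b \in Q :&: f by rewrite Qf inE.
  have : q0 \in Q :&: f; last by rewrite Qf inE (negPf q0b).
  rewrite inE q0Q; move: fE bf => /predU1P[->|/andP[_ fE]]; rewrite !inE.
    by rewrite eqxx andbF.
  by move=> /andP[_ bf]; apply: (subsetP (eb f fE bf)).
split=> [f fE|q qQ].
  have [->|fe] := eqVneq f e; first by exists q0.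
  by apply: cov; rewrite inE mem_filter fe fE orbT.
have [f] := priv q qQ; rewrite inE mem_filter.
move=> /predU1P[->|/andP[_ fE]] Qf; last by exists f.
exists e => //; rewrite -Qf setIDA; apply/esym/setDidPl.
by rewrite disjoint_sym disjoints1 inE (negPf bQ).
Qed.

(** [[set b]] is private to [b], and the private members of the elements of [Q] avoid [b]. *)
Lemma min_cover_cons E b Q : ([set b] : {set T}) \in E ->
  min_cover [seq f : {set _} <- E | b \notin f] Q ->
  b \notin Q /\ min_cover E (b |: Q).
Proof.
move=> bE [cov priv].
have bQ : b \notin Q.
  apply/negP => /priv[f]; rewrite mem_filter => /andP[bf _] Qf.
  have : b \in Q :&: f by rewrite Qf inE.
  by rewrite inE (negPf bf) andbF.
split=> //; split=> [f fE|q].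
  have [bf|bf] := boolP (b \in f); first by exists b => //; rewrite setU11.
  have [|q qQ qf] := cov f; first by rewrite mem_filter bf.
  by exists q => //; rewrite inE qQ orbT.
rewrite !inE => /predU1P[->|qQ].
  by exists [set b] => //; apply/setIidPr; rewrite sub1set setU11.
have [f] := priv q qQ; rewrite mem_filter => /andP[bf fE] <-; exists f => //.
by rewrite setIUl (_ : [set b] :&: f = set0) ?set0U //; apply/eqP;
  rewrite setI_eq0 disjoints1.
Qed.

(* Take [b] of maximal level and [e] of minimal cardinality through [b]. *)
Lemma nested_leaf E e0 : nested E -> set0 \notin E -> e0 \in E ->
  exists b e, [/\ e \in E, b \in e &
    forall f, f \in E -> b \in f -> e \subset f].
Proof.
move=> nE n0 e0E.
have /set0Pn[v0 v0e0] : e0 != set0 by apply: contraNneq n0 => <-.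
pose P v := has (fun e : {set T} => v \in e) E.
have Pv0 : P v0 by apply/hasP; exists e0.
have [b /hasP[e1 e1E be1] bmax] := @arg_maxnP _ v0 P lam Pv0.
pose P' (e : {set T}) := (e \in E) && (b \in e).
have Pe1 : P' e1 by rewrite /P' e1E.
have [e /andP[eE be] emin] := @arg_minnP _ e1 P' (fun e => #|e|) Pe1.
exists b, e; split=> // f fE bf.
(* By maximality of [b], members through [b] are comparable as whole sets, so the smallest lies in
   all others. *)
have bel g : g \in E -> below b g = g.
  move=> gE; apply/setP => u; rewrite inE; apply: andb_idr => ug.
  by apply: bmax; apply/hasP; exists g.
have /orP[] := nE e f b eE fE be bf; rewrite !bel // => sub.
have /eqP-> // : f == e.
by rewrite eqEcard sub emin // /P' fE.
Qed.

End NestedFamilies.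

(** * Projective dimension of ideals of nested families *)

Section EdgeIdealDimension.
Variables (k : fieldType) (N : nat) (lam : 'I_N -> nat).
Implicit Types E : seq {set 'I_N}.

(* With [e] and [b] as in [nested_leaf] and [m] the product of the variables of
   [e :\ b], multiplication by [m] gives
   [0 -> R/(I : m) -> R/I -> R/(I + (m)) -> 0], in which both outer ideals are
   again edge ideals of nested families, and every minimal cover of these is a
   minimal cover of [E]. If [m = 1], then [I = J + (x_b)] with [x_b] regular
   on [R/J], and [b] extends every minimal cover of [J]. *)
Lemma pd_le_edge_ideal E h : nested lam E ->
  (forall Q, min_cover E Q -> #|Q| <= h)%N ->
  pd_le h (quot_mod (edge_ideal k E)).
Proof.
have [n] := ubnP (\sum_(e <- E) #|e|)%N.
elim: n E h => // n IH E h; rewrite ltnS => leE nE mE.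
(* Degenerate families first: an empty member makes the quotient zero, and an empty family makes it
   free. *)
have [E0|n0] := boolP (set0 \in E).
  apply: pd_le_quot_full => x; apply/allP => a _; apply/hasP.
  by exists set0 => //; apply: sub0set.
have [->|[e0 e0E]] : E = [::] \/ exists e0, e0 \in E.
  by case: (E) => [|e0 E']; [left | right; exists e0; rewrite mem_head].
  apply: pd_le_quot_trivial; last exact: projective_regular.
  move=> x /allP xE; apply/eqP; rewrite -msupp_eq0; case: (msupp _) xE => // a s.
  by move/(_ a (mem_head _ _)).
have [b [e [eE be eb]]] := nested_leaf nE n0 e0E.
have domE (f : {set 'I_N}) a : f \in E -> f \subset mnm_supp a -> dominates E a.
  by move=> fE fa; apply/hasP; exists f.
have [eq_e|ne_e] := eqVneq e [set b].
  rewrite eq_e in eE eb => {e eq_e be}.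
  pose E0 := [seq f : {set _} <- E | b \notin f].
  have E0E : {subset E0 <= E} by apply: mem_subseq; apply: filter_subseq.
  have E0h Q : min_cover E0 Q -> (#|Q| < h)%N.
    by move=> /(min_cover_cons eE)[bQ /mE]; rewrite cardsU1 bQ.
  (* [h = 0] is impossible: the members of [E0] are nonempty, so the full set covers them and
     contains a minimal cover, of size below [h]. *)
  case: h {mE} E0h => [|h] E0h.
    have [e|Q _ /E0h] := @min_cover_ex _ E0 setT; last by rewrite ltn0.
    move=> /E0E eE0; have /set0Pn[q qe] : e != set0.
      by apply: contraNneq n0 => <-.
    by exists q.
  have pd0 : pd_le h (quot_mod (edge_ideal k E0)).
    apply: IH; [|exact: nested_sub nE|exact: E0h].
    apply: leq_trans leE; rewrite -addn1 -(cards1 b).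
    apply: sum_card_filter => //.
    by rewrite negbK set11.
  (* Members of [E0] avoid [b], so the colon ideal by the variable [b] is the ideal of [E0]
     itself. *)
  have [a|a|f [g fg]] := @edge_ideal_short_exact k N E0 E0 E [set b].
  - apply: eq_in_has => f; rewrite mem_filter => /andP[bf _].
    rewrite mnm_suppD mnm_supp_set; apply/idP/idP => [|fa].
      by move=> fa; rewrite subsetU // fa orbT.
    by move: fa; rewrite -subDset (setDidPl _) // disjoint_sym disjoints1.
  - apply/hasP/orP => [[f fE fa]|[/hasP[f /E0E fE fa]|ba]]; last first.
    + by exists [set b].
    + by exists f.
    have [bf|bf] := boolP (b \in f).
      by right; apply: subset_trans fa; apply: eb.
    by left; apply/hasP; exists f => //; rewrite mem_filter bf.
  - exact: pd_le_cokernel fg pd0 (pd_leS pd0).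
have be' : [set b] \proper e by rewrite properEneq eq_sym ne_e sub1set.
have [a|a|f [g fg]] := @edge_ideal_short_exact k N E
    [seq f :\: (e :\ b) | f <- E] (e :\ b :: [seq f <- E | f != e]) (e :\ b).
- rewrite /dominates has_map; apply: eq_has => f /=.
  by rewrite mnm_suppD mnm_supp_set subDset.
- apply/hasP/orP => [[f]|].
    rewrite inE mem_filter => /predU1P[->|/andP[_ fE]] fa; first by right.
    by left; apply: domE fa.
  move=> [/hasP[f fE fa]|ea]; last by exists (e :\ b) => //; apply: mem_head.
  have [fe|fe] := eqVneq f e; last first.
    by exists f => //; rewrite inE mem_filter fe fE orbT.
  exists (e :\ b); first exact: mem_head.
  by apply: subset_trans fa; rewrite fe subsetDl.
- apply: pd_le_extension fg _ _; apply: IH.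
  + apply: leq_trans leE; apply: sum_card_setD eE _.
    rewrite -setI_eq0 (setIidPr _) ?subsetDl // setD_eq0.
    by case/properP: be' => _ [x xe xb]; apply/subsetPn; exists x.
  + exact: nested_setD.
  + by move=> Q /min_cover_colon; apply: mE.
  + apply: leq_trans leE; rewrite big_cons addnC.
    apply: leq_trans (sum_card_filter (P := fun f => f != e) eE _).
      by rewrite ltn_add2l (cardsD1 b e) be.
    by rewrite eqxx.
  + exact: nested_shrink.
  + by move=> Q /(min_cover_shrink eE eb); apply: mE.
Qed.

End EdgeIdealDimension.

(** * Lower bound for the arithmetical rank *)

Section Counting.
Variables (k : fieldType) (h s : nat) (f : 'I_s -> {mpoly k[h]}).
Local Notation R := {mpoly k[h]}.
Implicit Types (p q r : R) (a m : 'X_{1..h}).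

(** Membership in the [j]-th power of the ideal of the variables. *)
Definition order_ge (j : nat) p := forall a, (mdeg a < j)%N -> p@_a = 0.

Lemma order_geD j p q : order_ge j p -> order_ge j q -> order_ge j (p + q).
Proof. by move=> pj qj a aj; rewrite mcoeffD pj ?qj ?addr0. Qed.

Lemma order_geM i j p q :
  order_ge i p -> order_ge j q -> order_ge (i + j) (p * q).
Proof.
move=> pi qj a aij; rewrite mcoeffM big1 // => -[m1 m2] /= /eqP aE.
have [/pi->|im1] := ltnP (mdeg m1) i; first by rewrite mul0r.
rewrite qj ?mulr0 // -(ltn_add2l (mdeg m1)) -mdegD -aE.
by apply: leq_trans aij _; rewrite leq_add2r.
Qed.

Definition pow_f (al : 'X_{1..s}) : R := \prod_i f i ^+ al i.

Definition spanned (d j : nat) p :=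
  exists2 l : seq (k * 'X_{1..h} * 'X_{1..s}),
    all (fun c => (mdeg c.1.2 < d) && (mdeg c.2 < j))%N l &
    p = \sum_(c <- l) c.1.1 *: ('X_[c.1.2] * pow_f c.2).

Definition approximated d j p := exists2 q, spanned d j q & order_ge j (p - q).

Lemma approximated0 d j : approximated d j 0.
Proof.
by exists 0 => [|a _]; [exists [::]; rewrite // big_nil|rewrite subr0 mcoeff0].
Qed.

Lemma approximatedD d j p q :
  approximated d j p -> approximated d j q -> approximated d j (p + q).
Proof.
move=> [p' [lp lpa ->] pp'] [q' [lq lqa ->] qq'].
eexists; first by exists (lp ++ lq); [rewrite all_cat lpa lqa|].
by rewrite big_cat /= opprD addrACA; apply: order_geD.
Qed.

Lemma approximatedZ d j c p : approximated d j p -> approximated d j (c *: p).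
Proof.
move=> [p' [l la ->] pp'].
exists (c *: \sum_(c <- l) c.1.1 *: ('X_[c.1.2] * pow_f c.2)) => [|a aj].
  exists [seq (c * x.1.1, x.1.2, x.2) | x <- l]; first by rewrite all_map.
  by rewrite big_map scaler_sumr; apply: eq_bigr => x _; rewrite scalerA.
by rewrite -scalerBr mcoeffZ pp' ?mulr0.
Qed.

(** Without constant term, [f i] raises the order of the error by one, while the exponents of the
    [f] monomials grow by one. *)
Lemma approximatedMf d j p i : (f i)@_0%MM = 0 ->
  approximated d j p -> approximated d j.+1 (p * f i).
Proof.
move=> fi0 [p' [l la ->] pp'].
exists ((\sum_(c <- l) c.1.1 *: ('X_[c.1.2] * pow_f c.2)) * f i).
  exists [seq (x.1, (x.2 + U_(i))%MM) | x <- l].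
    rewrite all_map; apply: sub_all la => x /= /andP[-> /=].
    by rewrite mdegD mdeg1 addn1.
  rewrite big_map mulr_suml; apply: eq_bigr => x _ /=.
  rewrite -scalerAl -mulrA; congr (_ *: (_ * _)).
  rewrite /pow_f (bigD1 i) //= [RHS](bigD1 i) //= mulrAC mnmDE mnm1E eqxx.
  rewrite addn1 exprSr; congr (_ * _); apply: eq_bigr => i' ii'.
  by rewrite mnmDE mnm1E eq_sym (negPf ii') addn0.
rewrite -mulrBl -addn1; apply: order_geM => // a.
by rewrite ltnS leqn0 mdeg_eq0 => /eqP->.
Qed.

(** Induction on [j]: a monomial of degree at least [d] is a combination of the [f i], whose
    coefficients need approximation to one order less. *)
Lemma approximated_all d j p : (forall i, (f i)@_0%MM = 0) ->
  (forall a, (d <= mdeg a)%N ->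
    exists r : 'I_s -> R, 'X_[a] = \sum_i r i * f i) ->
  approximated d j p.
Proof.
move=> f0 fd; elim: j p => [|j IH] p.
  by exists 0 => //; exists [::]; rewrite ?big_nil.
rewrite (mpolyE p); elim/big_rec: _ => [|a q _]; first exact: approximated0.
apply/approximatedD/approximatedZ => {q}.
have [ad|/fd[r ->]] := ltnP (mdeg a) d; last first.
  elim/big_rec: _ => [|i q _]; first exact: approximated0.
  by apply/approximatedD/approximatedMf.
exists 'X_[a]; last by move=> b _; rewrite subrr mcoeff0.
exists [:: (1, a, 0%MM)]; first by rewrite /= ad mdeg0.
rewrite big_seq1 scale1r /pow_f big1 ?mulr1 // => i _.
by rewrite mnm0E expr0.
Qed.

(** Compare dimensions in the space of coefficients at the [q ^ h] monomials with all exponents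
    below [q]. Their degrees are below [J], so errors of order [J] vanish there, and the products
    [w t] span the space. *)
Lemma card_box_le d (q : nat) : (forall j p, approximated d j p) ->
  (q ^ h <= (h * q).+1 ^ s * #|{: 'X_{1..h < d}}|)%N.
Proof.
move=> app; set J := (h * q).+1.
pose Box := {ffun 'I_h -> 'I_q}.
pose T := ({ffun 'I_s -> 'I_J} * 'X_{1..h < d})%type.
pose bm (b : Box) : 'X_{1..h} := [multinom (b i : nat) | i < h].
have bmJ b : (mdeg (bm b) < J)%N.
  rewrite ltnS mdegE -[X in (X * _)%N]card_ord -sum_nat_const.
  by apply: leq_sum => i _; rewrite mnmE ltnW.
pose row_of (p : R) : 'rV[k]_#|{: Box}| := \row_j p@_(bm (enum_val j)).
pose w (t : T) : R := 'X_[val t.2] * pow_f [multinom (t.1 i : nat) | i < s].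
pose M := \matrix_(i < #|{: T}|) row_of (w (enum_val i)).
have row_ofD p r : row_of (p + r) = row_of p + row_of r.
  by apply/rowP => j; rewrite !mxE mcoeffD.
have row_of0 : row_of 0 = 0 by apply/rowP => j; rewrite !mxE mcoeff0.
have row_ofZ c p : row_of (c *: p) = c *: row_of p.
  by apply/rowP => j; rewrite !mxE mcoeffZ.
have subM p : (row_of p <= M)%MS.
  have [r [l la rE] pr] := app J p.
  have -> : row_of p = row_of r.
    apply/rowP => j; rewrite !mxE; apply/eqP; rewrite -subr_eq0 -mcoeffB.
    by rewrite pr.
  rewrite {}rE (big_morph row_of row_ofD row_of0) big_seq.
  apply: summx_sub => -[[c m] al] /(allP la) /= /andP[md alJ].
  rewrite row_ofZ; apply: scalemx_sub.
  have ali i : (al i < J)%N.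
    by apply: leq_ltn_trans alJ; rewrite mdegE (bigD1 i) //= leq_addr.
  pose t : T := ([ffun i => Ordinal (ali i)], BMultinom md).
  have <- : row (enum_rank t) M = row_of ('X_[m] * pow_f al).
    rewrite rowK enum_rankK /w /=; congr (row_of (_ * pow_f _)).
    by apply/mnmP => i; rewrite mnmE ffunE.
  exact: row_sub.
have : (1%:M <= M)%MS.
  apply/row_subP => i; have -> : row i 1%:M = row_of 'X_[bm (enum_val i)].
    apply/rowP => j; rewrite !mxE mcoeffX; congr (_ %:R); congr nat_of_bool.
    rewrite -(inj_eq enum_val_inj); apply/eqP/eqP => [->//|/mnmP ij].
    by apply/ffunP => x; apply: val_inj; have := ij x; rewrite !mnmE.
  exact: subM.
move=> /mxrankS; rewrite mxrank1 => /leq_trans/(_ (rank_leq_row M)).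
by rewrite card_prod !card_ffun !card_ord.
Qed.

(* Modulo the [j]-th power of the ideal of the variables, the monomials grow
   like [j ^ h] while a finite set times the monomials of [f] grows at most
   like [j ^ s]. *)
Lemma variables_le_generators : (forall i, (f i)@_0%MM = 0) ->
  (forall c, exists n, exists r : 'I_s -> R, 'X_c ^+ n = \sum_i r i * f i) ->
  (h <= s)%N.
Proof.
(* Pigeonhole: a monomial of degree at least [d] is divisible by some variable [c] to the power
   [n c]. *)
move=> f0 /choice[n fn]; pose d := (\sum_c n c).+1.
have fd a : (d <= mdeg a)%N -> exists r : 'I_s -> R, 'X_[a] = \sum_i r i * f i.
  move=> da; have [c nc|an] := pickP (fun c => n c <= a c)%N.
    have [r rE] := fn c; exists (fun i => 'X_[a - U_(c) *+ n c] * r i).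
    under eq_bigr do rewrite -mulrA; rewrite -mulr_sumr -rE mpolyXn -mpolyXD.
    rewrite submK //; apply/mnm_lepP => i; rewrite mulmnE mnm1E.
    by case: eqVneq => [<-|]; rewrite ?mul1n ?mul0n.
  move: da; rewrite leqNgt ltnS mdegE leq_sum // => i _.
  by rewrite ltnW // ltnNge an.
have le (q : nat) := @card_box_le d q (fun j p => approximated_all j p f0 fd).
rewrite leqNgt; apply/negP => sh.
(* For [q = C.+1] and [s < h], the right side of [le] is at most [C * q ^ s], which is less than
   [q ^ s.+1] and so less than [q ^ h]. *)
set D := #|_| in le; pose C := (h.+1 ^ s * D)%N.
have := le C.+1; rewrite leqNgt => /negP; apply.
apply: (@leq_trans (C.+1 ^ s.+1)); last by rewrite leq_pexp2l.
have : ((h * C.+1).+1 ^ s <= (h.+1 * C.+1) ^ s)%N.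
  by case: (s) => // s'; rewrite leq_exp2r // mulSn addnC -addn1 leq_add2l.
move=> /(leq_mul (leqnn D)); rewrite mulnC => /leq_ltn_trans; apply.
by rewrite expnMn mulnA (mulnC D) -/C expnS ltn_mul2r expn_gt0 /=.
Qed.

End Counting.

(** * Minimal covers bound the number of generators up to radical *)

Section ArithmeticalRank.

Lemma ideal_gen_tuple (R : comNzRingType) s (f : s.-tuple R) (x : R) :
  (x : R^o) \in ideal_gen (fun y => y \in f) ->
  exists r : 'I_s -> R, x = \sum_i r i * tnth f i.
Proof.
move=> /asboolP[l]; elim: l x => [|[c y] l IH] x lf ->.
  by exists (fun=> 0); rewrite big_nil big1 // => i _; rewrite mul0r.
have [|r rE] := IH _ _ erefl.
  by move=> d dl; apply: lf; rewrite inE dl orbT.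
have /= /tnthP[i0 yE] := lf _ (mem_head _ _).
exists (fun i => r i + (if i == i0 then c else 0)).
rewrite big_cons rE /=; under [RHS]eq_bigr do rewrite mulrDl.
rewrite big_split /= addrC; congr (_ + _).
rewrite (bigD1 i0) //= eqxx yE big1 ?addr0 // => i /negPf->.
by rewrite mul0r.
Qed.

Lemma mem_ideal_gen (R : comNzRingType) (S : R -> Prop) (x : R) :
  S x -> (x : R^o) \in ideal_gen S.
Proof.
move=> Sx; apply/asboolP; exists [:: (1, x)].
  by move=> c; rewrite inE => /eqP->.
by rewrite big_seq1 mul1r.
Qed.

Variables (k : fieldType) (N : nat).
Local Notation R := {mpoly k[N]}.
Implicit Types (E : seq {set 'I_N}) (Q : {set 'I_N}).

(* Sets the variables outside [Q] to 1. *)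
Definition dehomog Q : N.-tuple {mpoly k[#|Q|]} :=
  [tuple \prod_(c < #|Q| | enum_val c == v) 'X_c | v < N].

Lemma dehomog_in Q c : tnth (dehomog Q) (enum_val c) = 'X_c.
Proof.
rewrite tnth_mktuple (bigD1 c) //= big1 ?mulr1 // => i /andP[/eqP/enum_val_inj->].
by rewrite eqxx.
Qed.

Lemma dehomog_out Q v : v \notin Q -> tnth (dehomog Q) v = 1.
Proof.
move=> vQ; rewrite tnth_mktuple big1 // => i /eqP vE.
by rewrite -vE enum_valP in vQ.
Qed.

Lemma dehomog_edge Q e c : Q :&: e = [set enum_val c] ->
  ('X_[mnm_set e] : R) \mPo dehomog Q = 'X_c.
Proof.
move=> Qe; have ce : enum_val c \in Q :&: e by rewrite Qe set11.
rewrite comp_mpolyX (bigD1 (enum_val c)) //= dehomog_in mnmE.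
move: (ce); rewrite inE => /andP[_ ->]; rewrite expr1 big1 ?mulr1 // => i ic.
rewrite mnmE; have [ie|] := boolP (i \in e); last by rewrite expr0.
rewrite dehomog_out ?expr1n //; apply: contra ic => iQ.
by rewrite -in_set1 -Qe inE iQ.
Qed.

(** Every monomial of the ideal contains a variable of the cover [Q], which the substitution
    keeps. *)
Lemma dehomog_ideal E Q (p : R) :
  (forall e, e \in E -> exists2 q, q \in Q & q \in e) ->
  (p : R^o) \in edge_ideal k E -> (p \mPo dehomog Q)@_0%MM = 0.
Proof.
move=> cov /allP pE; rewrite comp_mpolyEX big_seq raddf_sum big1 //= => a ap.
have /hasP[e eE ea] := pE a ap; have [q qQ qe] := cov e eE.
rewrite mcoeffZ comp_mpolyX rmorph_prod (bigD1 q) //= rmorphXn /=.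
rewrite -[q](enum_rankK_in qQ qQ) dehomog_in mcoeffX.
have -> : (U_(enum_rank_in qQ q) == 0 :> 'X_{1..#|Q|})%MM = false.
  by rewrite -mdeg_eq0 mdeg1.
rewrite expr0n enum_rankK_in //; have := subsetP ea q qe.
by rewrite inE => /negPf->; rewrite mul0r mulr0.
Qed.

(** The dehomogenized [f] satisfy [variables_le_generators]: powers of them come from the edge
    ideal, so their constant terms vanish, and the private member of each variable of [Q] becomes
    that variable. *)
Lemma min_cover_le_ara E Q s (f : s.-tuple R) : min_cover E Q ->
  radical (edge_ideal k E : {pred R}) =i
    radical (ideal_gen (fun x => x \in f) : {pred R}) ->
  (#|Q| <= s)%N.
Proof.
move=> [cov priv] radE.
apply: (@variables_le_generators k #|Q| s (fun i => tnth f i \mPo dehomog Q)).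
  move=> i; have : tnth f i \in radical (edge_ideal k E : {pred R}).
    rewrite radE; apply/asboolP; exists 1%N; rewrite expr1.
    by apply: mem_ideal_gen; apply: mem_tnth.
  move=> /asboolP[n /(dehomog_ideal cov)]; rewrite rmorphXn rmorphXn /= => /eqP.
  by rewrite expf_eq0 => /andP[_ /eqP].
move=> c; have [e eE Qe] := priv _ (enum_valP c).
have : ('X_[mnm_set e] : R) \in radical (ideal_gen (fun x => x \in f) : {pred R}).
  rewrite -radE; apply/asboolP; exists 1%N; rewrite expr1 edge_idealX.
  by apply/hasP; exists e => //; rewrite mnm_supp_set.
move=> /asboolP[n /ideal_gen_tuple[r rE]].
exists n, (fun i => r i \mPo dehomog Q).
rewrite -(dehomog_edge Qe) -rmorphXn rE rmorph_sum.
by apply: eq_bigr => i _; rewrite rmorphM.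
Qed.

End ArithmeticalRank.

(** * Restriction of scalars *)

(* A copy of [M], so that the scalars [R1] act through [phi]. *)
Definition restr (R1 R2 : nzRingType) (phi : {rmorphism R1 -> R2})
  (M : lmodType R2) : Type := M.

Section RestrictionOfScalars.
Variables (R1 R2 : nzRingType) (phi : {rmorphism R1 -> R2}).

Section Module.
Variable M : lmodType R2.

Local Notation restrM := (restr phi M).
HB.instance Definition _ := GRing.Zmodule.on restrM.

Definition restr_scale (a : R1) (x : restrM) : restrM := phi a *: (x : M).

Fact restr_scaleA a b x :
  restr_scale a (restr_scale b x) = restr_scale (a * b) x.
Proof. by rewrite /restr_scale scalerA rmorphM. Qed.

Fact restr_scale1 : left_id 1 restr_scale.
Proof. by move=> x; rewrite /restr_scale rmorph1 scale1r. Qed.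

Fact restr_scaleDr : right_distributive restr_scale +%R.
Proof. by move=> a x y; rewrite /restr_scale scalerDr. Qed.

Fact restr_scaleDl x : {morph restr_scale^~ x : a b / a + b}.
Proof. by move=> a b; rewrite /restr_scale rmorphD scalerDl. Qed.

HB.instance Definition _ := GRing.Zmodule_isLmodule.Build R1 restrM
  restr_scaleA restr_scale1 restr_scaleDr restr_scaleDl.

Lemma restr_scaleE a (x : restrM) : a *: x = phi a *: (x : M).
Proof. by []. Qed.

End Module.

Fact restr_linear (M N : lmodType R2) (f : {linear M -> N}) :
  linear (f : restr phi M -> restr phi N).
Proof. by move=> a x y; rewrite !restr_scaleE linearP. Qed.

Definition restrm (M N : lmodType R2) (f : {linear M -> N}) :
  {linear restr phi M -> restr phi N} := mk_linear (restr_linear f).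

(* The coextension of scalars Hom_R1(R2, M), right adjoint to [restr]. *)
Section Coextension.
Variable M : lmodType R1.

Record coext := Coext {
  coext_fun :> R2 -> M;
  coextP : forall a x y,
    coext_fun (phi a * x + y) = a *: coext_fun x + coext_fun y
}.

HB.instance Definition _ := gen_eqMixin coext.
HB.instance Definition _ := gen_choiceMixin coext.

Lemma coext_eq (u v : coext) : u =1 v -> u = v.
Proof.
case: u v => [u uP] [v vP] /= /funext uv; rewrite uv in uP *.
by congr Coext; apply: Prop_irrelevance.
Qed.

Program Definition coext0 := @Coext (fun=> 0) _.
Next Obligation. by rewrite scaler0 addr0. Qed.

Program Definition coext_opp (u : coext) := @Coext (fun x => - u x) _.
Next Obligation. by rewrite coextP opprD scalerN. Qed.

Program Definition coext_add (u v : coext) := @Coext (fun x => u x + v x) _.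
Next Obligation. by rewrite !coextP scalerDr addrACA. Qed.

Program Definition coext_scale (r : R2) (u : coext) :=
  @Coext (fun x => u (x * r)) _.
Next Obligation. by rewrite mulrDl -mulrA coextP. Qed.

Fact coext_addA : associative coext_add.
Proof. by move=> u v w; apply: coext_eq => x; apply: addrA. Qed.

Fact coext_addC : commutative coext_add.
Proof. by move=> u v; apply: coext_eq => x; apply: addrC. Qed.

Fact coext_add0 : left_id coext0 coext_add.
Proof. by move=> u; apply: coext_eq => x; apply: add0r. Qed.

Fact coext_addN : left_inverse coext0 coext_opp coext_add.
Proof. by move=> u; apply: coext_eq => x; apply: addNr. Qed.

HB.instance Definition _ := GRing.isZmodule.Build coext
  coext_addA coext_addC coext_add0 coext_addN.

Lemma coextD (u : coext) x y : u (x + y) = u x + u y.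
Proof. by have := coextP u 1 x y; rewrite rmorph1 mul1r scale1r. Qed.

Lemma coextZ (u : coext) a x : u (phi a * x) = a *: u x.
Proof.
have u0 : u 0 = 0 by apply: (addrI (u 0)); rewrite -coextD !addr0.
by have := coextP u a x 0; rewrite !addr0 u0 addr0.
Qed.

Fact coext_scaleA a b u :
  coext_scale a (coext_scale b u) = coext_scale (a * b) u.
Proof. by apply: coext_eq => x /=; rewrite mulrA. Qed.

Fact coext_scale1 : left_id 1 coext_scale.
Proof. by move=> u; apply: coext_eq => x /=; rewrite mulr1. Qed.

Fact coext_scaleDr : right_distributive coext_scale +%R.
Proof. by move=> a u v; apply: coext_eq. Qed.

Fact coext_scaleDl u : {morph coext_scale^~ u : a b / a + b}.
Proof. by move=> a b; apply: coext_eq => x /=; rewrite mulrDr coextD. Qed.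

HB.instance Definition _ := GRing.Zmodule_isLmodule.Build R2 coext
  coext_scaleA coext_scale1 coext_scaleDr coext_scaleDl.

End Coextension.

(** By adjunction, lifting a map from [restr phi P] along [f] amounts to lifting a map from [P]
    along the coextension [cf], which stays surjective because [R2] is projective over [R1]. *)
Lemma projective_restr (P : lmodType R2) :
  projective (restr phi R2^o) -> projective P -> projective (restr phi P).
Proof.
move=> pR pP M N f g sf.
have cfP (u : coext M) a x y : f (u (phi a * x + y)) = a *: f (u x) + f (u y).
  by rewrite coextP linearP.
pose cf (u : coext M) := Coext (cfP u).
have cf_lin : linear cf by move=> r u v; apply: coext_eq => x; apply: linearD.
have cgP (p : P) a x y :
    g ((phi a * x + y) *: p) = a *: g (x *: p) + g (y *: p).
  by rewrite -linearP restr_scaleE scalerA scalerDl.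
pose cg (p : P) := @Coext N (fun x => g (x *: p)) (cgP p).
have cg_lin : linear cg.
  move=> r p q; apply: coext_eq => x /=.
  by rewrite scalerDr scalerA (linearD g).
have scf : surj (mk_linear cf_lin).
  move=> u; have u_lin : linear (u : restr phi R2^o -> N).
    by move=> a x y; rewrite -coextP.
  have [h hE] := pR M N f (mk_linear u_lin) sf.
  have hP a x y : h (phi a * x + y) = a *: h x + h y by rewrite -linearP.
  by exists (Coext hP); apply: coext_eq => x; apply: hE.
have [G GE] := pP _ _ (mk_linear cf_lin) (mk_linear cg_lin) scf.
(* Evaluation at 1 transposes [G] back. *)
have h_lin : linear ((fun p => G p 1) : restr phi P -> M).
  move=> a p q; rewrite restr_scaleE linearP; congr (_ + _).
  by rewrite -coextZ mulr1; congr (G p _); apply: mul1r.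
exists (mk_linear h_lin) => p /=.
by have /(congr1 (fun u : coext N => u 1)) := GE p; rewrite /= scale1r.
Qed.

End RestrictionOfScalars.

(** * Projective dimension along a retract of rings *)

Section RetractOfRings.
Variables (R1 R2 : nzRingType) (phi : {rmorphism R1 -> R2}).

Lemma pd_le_restr l (M : lmodType R2) :
  projective (restr phi R2^o) -> pd_le l M -> pd_le l (restr phi M).
Proof.
move=> pR; elim: l M => [M|l IH M [K [P [i [p [[iI pS ip] pP /IH pK]]]]]].
  exact: projective_restr.
exists (restr phi K), (restr phi P), (restrm phi i), (restrm phi p).
by split=> //; apply: projective_restr.
Qed.

Lemma pd_le_quot_retract (psi : {rmorphism R2 -> R1}) l
    (W1 : submodClosed R1^o) (W2 : submodClosed R2^o) :
  cancel phi psi -> projective (restr phi R2^o) ->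
  (forall x : R1, (x : R1^o) \in W1 -> (phi x : R2^o) \in W2) ->
  (forall x : R2, (x : R2^o) \in W2 -> (psi x : R1^o) \in W1) ->
  pd_le l (quot_mod W2) -> pd_le l (quot_mod W1).
Proof.
move=> phiK pR phiW psiW.
have i_lin : linear ((fun x : R1^o => quot_proj W2 (phi x)) :
    R1^o -> restr phi (quot_mod W2)).
  by move=> a x y; rewrite rmorphD rmorphM restr_scaleE -linearP.
have [i iE] : exists i : {linear quot_mod W1 -> restr phi (quot_mod W2)},
    forall x, i (quot_proj W1 x) = mk_linear i_lin x.
  by apply: quot_lift => x /phiW/quot_proj_eq0.
have r_lin : linear ((fun x : R2^o => quot_proj W1 (psi x)) :
    R2^o -> restr psi (quot_mod W1)).
  by move=> a x y; rewrite rmorphD rmorphM restr_scaleE -linearP.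
have [r rE] : exists r : {linear quot_mod W2 -> restr psi (quot_mod W1)},
    forall x, r (quot_proj W2 x) = mk_linear r_lin x.
  by apply: quot_lift => x /psiW/quot_proj_eq0.
(* Scalars from [R1] act on the target through [psi] after [phi], which is the identity. *)
have r'_lin : linear (r : restr phi (quot_mod W2) -> quot_mod W1).
  by move=> a x y; rewrite restr_scaleE linearP restr_scaleE phiK.
move=> /(pd_le_restr pR); apply: (pd_le_retract (i := i) (r := mk_linear r'_lin)).
move=> y; have [x <-] := quot_proj_surj y.
by rewrite iE /= rE /= phiK.
Qed.

End RetractOfRings.

(** * Additive maps on polynomials given on monomials *)

Section PolynomialExtension.
Variables (k : fieldType) (n : nat).
Local Notation R := {mpoly k[n]}.

Section LinearExtension.
Variables (V : zmodType) (F : 'X_{1..n} -> {additive k -> V}).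

Definition mnm_ext (p : R) : V := \sum_(a <- msupp p) F a p@_a.

(** A common index set for polynomials with different supports, as additivity requires. *)
Lemma mnm_extE (p : R) d : (msize p <= d)%N ->
  mnm_ext p = \sum_(a : 'X_{1..n < d}) F a p@_a.
Proof.
move=> pd; rewrite /mnm_ext (big_mksub 'X_{1..n < d}) ?msupp_uniq //=; last first.
  by move=> x /msize_mdeg_lt /leq_trans; apply.
rewrite big_rmcond //= => j /memN_msupp_eq0 ->.
by rewrite raddf0.
Qed.

Lemma mnm_extD p q : mnm_ext (p + q) = mnm_ext p + mnm_ext q.
Proof.
pose d := maxn (msize (p + q)) (maxn (msize p) (msize q)).
rewrite !(@mnm_extE _ d) ?leq_max ?leqnn ?orbT // -big_split.
by apply: eq_bigr => a _; rewrite mcoeffD raddfD.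
Qed.

Lemma mnm_ext0 : mnm_ext 0 = 0.
Proof. by rewrite /mnm_ext msupp0 big_nil. Qed.

Lemma mnm_extZX c a : mnm_ext (c *: 'X_[a]) = F a c.
Proof.
have [->|c0] := eqVneq c 0; first by rewrite scale0r mnm_ext0 raddf0.
by rewrite /mnm_ext msuppMCX // big_seq1 mcoeffZ mcoeffX eqxx mulr1.
Qed.

End LinearExtension.

Lemma mpoly_additive_ind (P : R -> Prop) : P 0 ->
  (forall p q, P p -> P q -> P (p + q)) -> (forall c a, P (c *: 'X_[a])) ->
  forall p, P p.
Proof.
move=> P0 PD PX p; rewrite (mpolyE p).
by elim/big_rec: _ => // a q _ Pq; apply: PD.
Qed.

End PolynomialExtension.

(** * Inclusion of a subset of the variables and its retraction *)

Section VariableInclusion.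
Variables (k : fieldType) (n1 n2 : nat) (iota : 'I_n1 -> 'I_n2).
Hypothesis iota_inj : injective iota.
Local Notation R1 := {mpoly k[n1]}.
Local Notation R2 := {mpoly k[n2]}.

Definition var_incl : {rmorphism R1 -> R2} :=
  comp_mpoly [tuple 'X_(iota i) | i < n1].

(** As [iota] is injective, the sum has one term on its image and none elsewhere. *)
Definition var_kill : {rmorphism R2 -> R1} :=
  comp_mpoly [tuple \sum_(i | iota i == j) 'X_i | j < n2].

Lemma var_inclX i : var_incl 'X_i = 'X_(iota i).
Proof. by rewrite /= comp_mpolyXU -tnth_nth tnth_mktuple. Qed.

Lemma var_killX i : var_kill 'X_(iota i) = 'X_i.
Proof.
rewrite /= comp_mpolyXU -tnth_nth tnth_mktuple (big_pred1 i) // => j.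
by rewrite (inj_eq iota_inj).
Qed.

Lemma var_killX0 j : j \notin codom iota -> var_kill 'X_j = 0.
Proof.
move=> jN; rewrite /= comp_mpolyXU -tnth_nth tnth_mktuple big_pred0 // => i.
by apply: contraNF jN => /eqP<-; apply: codom_f.
Qed.

Lemma var_inclZ c p : var_incl (c *: p) = c *: var_incl p.
Proof. exact: linearZ. Qed.

Lemma var_killZ c p : var_kill (c *: p) = c *: var_kill p.
Proof. exact: linearZ. Qed.

Definition inner (a : 'X_{1..n2}) : 'X_{1..n1} := [multinom a (iota i) | i < n1].

Definition outer (a : 'X_{1..n2}) : 'X_{1..n2} :=
  [multinom (if j \in codom iota then 0%N else a j) | j < n2].

Definition push (a : 'X_{1..n1}) : 'X_{1..n2} :=
  (\big[mnm_add/0]_i (U_(iota i) *+ a i))%MM.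

Lemma pushE a j : push a j = (\sum_(i | iota i == j) a i)%N.
Proof.
rewrite mnm_sumE [RHS]big_mkcond; apply: eq_bigr => i _.
by rewrite mulmnE mnm1E; case: eqP; rewrite ?mul1n.
Qed.

Lemma push_iota a i : push a (iota i) = a i.
Proof. by rewrite pushE (big_pred1 i) // => j; rewrite (inj_eq iota_inj). Qed.

Lemma push_out a j : j \notin codom iota -> push a j = 0%N.
Proof.
move=> jN; rewrite pushE big_pred0 // => i.
by apply: contraNF jN => /eqP<-; apply: codom_f.
Qed.

Lemma var_inclXm a : var_incl 'X_[a] = 'X_[push a].
Proof.
rewrite /= comp_mpolyX /push -mprodXnE; apply: eq_bigr => i _.
by rewrite tnth_mktuple.
Qed.

Lemma var_inclK : cancel var_incl var_kill.
Proof.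
elim/mpoly_additive_ind => [|p q pK qK|c a]; first by rewrite !rmorph0.
  by rewrite !rmorphD pK qK.
rewrite var_inclZ var_killZ var_inclXm; congr (_ *: _).
rewrite /push -mprodXnE rmorph_prod [RHS]mpolyXE_id; apply: eq_bigr => i _.
by rewrite rmorphXn var_killX.
Qed.

Lemma push_inner_outer a : (push (inner a) + outer a)%MM = a.
Proof.
apply/mnmP => j; rewrite mnmDE [outer _ _]mnmE.
have [/codomP[i ->]|jN] := boolP (j \in codom iota).
  by rewrite push_iota mnmE addn0.
by rewrite push_out.
Qed.

Lemma inner_push b a : inner (push b + a)%MM = (b + inner a)%MM.
Proof.
by apply/mnmP => i; rewrite [LHS]mnmE !mnmDE push_iota [inner a _]mnmE.
Qed.

Lemma outer_push b a : outer (push b + a)%MM = outer a.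
Proof.
apply/mnmP => j; rewrite [LHS]mnmE [RHS]mnmE; case: ifPn => // jN.
by rewrite mnmDE push_out.
Qed.

(* The monomials in the variables outside the image of [iota] form a basis of
   [R2] over [R1]. *)
Lemma projective_var_incl : projective (restr var_incl R2^o).
Proof.
move=> M N f g sf; have [s sE] := choice sf.
(* The lift is chosen on the basis monomials [outer a] and extended by the scalar [inner a]. *)
pose G (a : 'X_{1..n2}) : M := 'X_[inner a] *: s (g 'X_[outer a]).
have F_add a : additive (fun c : k => (c%:MP : R1) *: G a).
  by move=> c d; rewrite mpolyCB scalerBl.
pose F a : {additive k -> M} :=
  HB.pack (fun c : k => (c%:MP : R1) *: G a)
    (GRing.isAdditive.Build _ _ _ (F_add a)).
pose h := mnm_ext F.
have hX c a : h (c *: 'X_[a]) = (c%:MP : R1) *: G a by apply: mnm_extZX.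
have hM (r : R1) (p : R2) : h (var_incl r * p) = r *: h p.
  elim/mpoly_additive_ind: r p => [p|r1 r2 IH1 IH2 p|c b p].
  - by rewrite rmorph0 mul0r scale0r; apply: mnm_ext0.
  - by rewrite rmorphD mulrDl scalerDl -IH1 -IH2; apply: mnm_extD.
  elim/mpoly_additive_ind: p => [|p1 p2 IH1 IH2|d a].
  - by rewrite mulr0 [h 0]mnm_ext0 scaler0.
  - by rewrite mulrDr [h (p1 + p2)]mnm_extD scalerDr -IH1 -IH2; apply: mnm_extD.
  rewrite var_inclZ var_inclXm -scalerAl -scalerAr scalerA -mpolyXD !hX /G.
  rewrite inner_push outer_push !scalerA; congr (_ *: _).
  by rewrite mpolyCM mpolyXD -mul_mpolyC !mulrA; congr (_ * _); rewrite mulrAC.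
have h_lin : linear (h : restr var_incl R2^o -> M).
  move=> a p q; rewrite restr_scaleE -hM; exact: mnm_extD.
exists (mk_linear h_lin) => p /=.
elim/mpoly_additive_ind: p => [|p q IH1 IH2|c a].
- by rewrite [h 0]mnm_ext0 !linear0.
- by rewrite [h _]mnm_extD !linearD IH1 IH2.
rewrite hX /G scalerA linearZ sE -linearZ; congr (g _).
rewrite restr_scaleE rmorphM var_inclXm.
have -> : var_incl c%:MP = c%:MP by apply: comp_mpolyC.
rewrite mul_mpolyC; have := scalerAl c ('X_[push (inner a)] : R2) 'X_[outer a].
by rewrite -mpolyXD push_inner_outer.
Qed.

End VariableInclusion.

Lemma natinf_min_mono (P Q : nat -> Prop) : (forall n, Q n -> P n) ->
  natinf_le (natinf_min P) (natinf_min Q).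
Proof.
move=> QP; rewrite /natinf_min.
case: (pselect (exists n, Q n)) => [hQ|_]; last by case: pselect.
case: ex_minnP => m /asboolP/QP Pm _; case: pselect => [hP|[]]; last by exists m.
by case: ex_minnP => m' _; apply; apply/asboolP.
Qed.

(** * Rooted trees and their path ideals *)

Section Trees.
Local Open Scope nat_scope.
Variables (V : finType) (T : rooted_tree V).
Implicit Types (x y z v : V) (p q : seq V).

Local Notation root := (Defs.root T).
Local Notation lev := (level T).
Local Notation rp := (root_path T).
Local Notation dpath p := (sorted (dedge T) p).

Lemma joins_inj x y p q : joins (edge T) x y p -> joins (edge T) x y q -> p = q.
Proof.
have [->|/edge_uniq_path-/(_ T)[r [_ rE]]] := eqVneq x y; last first.
  by move=> /rE <- /rE.
have nil r : joins (edge T) y y r -> r = [::].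
  case/and3P=> _; case/lastP: r => // r z /=.
  rewrite last_rcons => /andP[yN _] /eqP zy.
  by rewrite zy mem_rcons mem_head in yN.
by move=> /nil-> /nil->.
Qed.

Lemma root_path_joins x : joins (edge T) root x (rp x).
Proof. exact: xchooseP (tree_path_ex T x). Qed.

Lemma level_joins x p : joins (edge T) root x p -> lev x = size p.
Proof. by move=> jp; rewrite /level (joins_inj (root_path_joins x) jp). Qed.

Lemma joins_take x y p : joins (edge T) x y p -> forall i, i <= size p ->
  joins (edge T) x (nth x (x :: p) i) (take i p).
Proof.
case/and3P=> pp up _ i ip; rewrite /joins take_path //=.
move: up; rewrite -[x :: p](cat_take_drop i.+1) cat_uniq => /andP[/= -> _] /=.
case: i ip => [|i] ip; first by rewrite take0 eqxx.
by rewrite (last_nth x) size_takel //= nth_take // cat_take_drop.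
Qed.

(** If [y] already lay on the root path of [x], a prefix of that path would be the root path of [y],
    and [y] would have level at most that of [x]. *)
Lemma dedge_root_path x y : dedge T x y -> rp y = rcons (rp x) y.
Proof.
move=> /andP[exy lxy]; apply: joins_inj (root_path_joins y) _.
have jx := root_path_joins x; case/and3P: (jx) => px ux /eqP lastx.
rewrite /joins rcons_path px lastx exy last_rcons eqxx -rcons_cons rcons_uniq ux.
rewrite !andbT /=; apply/negP => yx; move: lxy; rewrite ltnNge => /negP; apply.
have [i iz yE] := nthP root yx.
rewrite -yE (level_joins (joins_take jx iz)) (level_joins jx) size_take.
by case: ifP => // _; rewrite ltnW.
Qed.

Lemma dedge_parent_inj x y z : dedge T x z -> dedge T y z -> x = y.
Proof.
move=> /dedge_root_path xz /dedge_root_path; rewrite xz => /rcons_inj[xy].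
have /and3P[_ _ /eqP<-] := root_path_joins x.
by have /and3P[_ _ /eqP<-] := root_path_joins y; rewrite xy.
Qed.

Lemma level_root_path x i : i <= lev x -> lev (nth root (root :: rp x) i) = i.
Proof.
move=> ix; rewrite (level_joins (joins_take (root_path_joins x) ix)).
exact: size_takel.
Qed.

Lemma dedge_nth_root_path x i : i < lev x ->
  dedge T (nth root (root :: rp x) i) (nth root (root :: rp x) i.+1).
Proof.
move=> ix; rewrite /dedge !level_root_path ?(ltnW ix) // ltnSn andbT.
have /and3P[/(pathP root) px _ _] := root_path_joins x; exact: px.
Qed.

Lemma height_ex : exists x, lev x = height T.
Proof.
have [|x xE] := @eq_bigmax V lev; last by exists x; rewrite -xE.
by apply/card_gt0P; exists root.
Qed.

Lemma dpath_level p : dpath p -> sorted (relpre lev ltn) p.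
Proof. by apply: sub_sorted => x y /andP[]. Qed.

Lemma level_ltn_trans : transitive (relpre lev ltn).
Proof. by move=> y x z; apply: ltn_trans. Qed.

Lemma dpath_uniq p : dpath p -> uniq p.
Proof.
move=> /dpath_level; apply: sorted_uniq; first exact: level_ltn_trans.
by move=> x /=; apply: ltnn.
Qed.

(** Levels increase strictly along a directed path. *)
Lemma dpath_below p1 v p2 : dpath (p1 ++ v :: p2) ->
  forall u, (u \in p1 ++ v :: p2) && (lev u <= lev v) = (u \in rcons p1 v).
Proof.
move=> /dpath_level; rewrite (sorted_pairwise level_ltn_trans) pairwise_cat /=.
move=> /and4P[/allrelP lt12 _ /allP ltv _] u.
rewrite mem_cat mem_rcons !inE.
have [->|uv] := eqVneq u v; first by rewrite orbT leqnn.
have [u1|_] /= := boolP (u \in p1).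
  by rewrite (ltnW (lt12 _ _ u1 (mem_head _ _))).
by apply/negP => /andP[/ltv /=]; rewrite ltnNge => /negP.
Qed.

(** Parents are unique, so the two paths agree backwards from [v] until the shorter one ends. *)
Lemma dpath_rcons_sub p q v : dpath (rcons p v) -> dpath (rcons q v) ->
  size p <= size q -> {subset rcons p v <= rcons q v}.
Proof.
have dpE s x y : dpath (rcons (rcons s x) y) = dpath (rcons s x) && dedge T x y.
  by rewrite -[rcons (rcons s x) y]cats1 cat_rcons sorted_cat_cons /= andbT.
elim/last_ind: p q v => [|p x IH] q v.
  by move=> _ _ _ u; rewrite inE => /eqP->; rewrite mem_rcons mem_head.
case/lastP: q => [|q y]; first by rewrite size_rcons.
rewrite !dpE !size_rcons => /andP[px xv] /andP[qy yv].
have xy := dedge_parent_inj xv yv; subst y.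
move=> pq u; rewrite mem_rcons [u \in rcons _ v]mem_rcons !inE.
by case: eqP => // _ /(IH _ _ px qy pq).
Qed.

Lemma dpath_nested p q v : dpath p -> dpath q -> v \in p -> v \in q ->
  {subset [seq u <- p | lev u <= lev v] <= [seq u <- q | lev u <= lev v]} \/
  {subset [seq u <- q | lev u <= lev v] <= [seq u <- p | lev u <= lev v]}.
Proof.
move=> + + /splitPr vp /splitPr vq; case: vp vq => p1 p2 [q1 q2] dp dq.
have pE u :
    (u \in [seq u <- p1 ++ v :: p2 | lev u <= lev v]) = (u \in rcons p1 v).
  by rewrite mem_filter andbC dpath_below.
have qE u :
    (u \in [seq u <- q1 ++ v :: q2 | lev u <= lev v]) = (u \in rcons q1 v).
  by rewrite mem_filter andbC dpath_below.
have dp1 : dpath (rcons p1 v) by move: dp; rewrite sorted_cat_cons => /andP[].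
have dq1 : dpath (rcons q1 v) by move: dq; rewrite sorted_cat_cons => /andP[].
case: (leqP (size p1) (size q1)) => [|/ltnW] le; [left|right] => u;
  rewrite pE qE; exact: dpath_rcons_sub.
Qed.

End Trees.

(** * Path ideals as ideals of nested families *)

Section PathIdealEdges.

Lemma ideal_gen_map (R S : comNzRingType) (phi : {rmorphism R -> S})
    (P : R -> Prop) (W : submodClosed S^o) :
  (forall x, P x -> (phi x : S^o) \in W) ->
  forall x : R, (x : R^o) \in ideal_gen P -> (phi x : S^o) \in W.
Proof.
move=> PW x /asboolP[s sP ->]; rewrite rmorph_sum big_seq rpred_sum // => c cs.
by rewrite rmorphM; apply/(@rpredZ _ _ W)/PW/sP.
Qed.

Lemma ideal_gen_edge (k : fieldType) N (E : seq {set 'I_N})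
    (P : {mpoly k[N]} -> Prop) :
  (forall x, P x <-> exists2 e, e \in E & x = 'X_[mnm_set e]) ->
  ideal_gen P =i edge_ideal k E.
Proof.
move=> PE x; apply/idP/idP => [|/allP xE].
  apply: (@ideal_gen_map _ _ idfun) => _ /PE[e eE ->] /=.
  by rewrite edge_idealX; apply/hasP; exists e => //; rewrite mnm_supp_set.
rewrite [x]mpolyE big_seq rpred_sum // => a /xE/hasP[e eE].
rewrite -mnm_set_le -mul_mpolyC => /submK <-; rewrite mpolyXD mulrA.
by apply/(@rpredZ _ _ (ideal_gen P))/mem_ideal_gen/PE; exists e.
Qed.

Variables (k : fieldType) (V : finType) (T : rooted_tree V) (t : nat).

Definition path_edges : seq {set 'I_#|V|} :=
  [seq [set i | enum_val i \in (p : seq V)] |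
     p : t.-tuple V <- enum {: t.-tuple V} & sorted (dedge T) p].

Lemma path_edgesP (e : {set 'I_#|V|}) :
  reflect (exists2 p : t.-tuple V, sorted (dedge T) p &
             e = [set i | enum_val i \in (p : seq V)])
    (e \in path_edges).
Proof.
apply: (iffP mapP) => [[p]|[p dp ->]].
  by rewrite mem_filter => /andP[dp _] ->; exists p.
by exists p; rewrite // mem_filter dp mem_enum.
Qed.

Lemma prod_vertex_var (p : seq V) : uniq p ->
  \prod_(v <- p) vertex_var k v = 'X_[mnm_set [set i | enum_val i \in p]].
Proof.
move=> up; rewrite mpolyXE_id big_uniq //= (reindex (@enum_val V V)) /=; last first.
  by apply: onW_bij; apply: enum_val_bij.
rewrite big_mkcond; apply: eq_bigr => i _; rewrite /vertex_var enum_valK mnmE inE.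
by case: ifP.
Qed.

(** The vertices of a directed path are distinct, so the generators are squarefree. *)
Lemma path_ideal_edges : path_ideal k (dedge T) t =i edge_ideal k path_edges.
Proof.
apply: ideal_gen_edge => x; split=> [[p dp ->]|[_ /path_edgesP[p dp ->] ->]].
  rewrite (prod_vertex_var (dpath_uniq dp)); eexists; last reflexivity.
  by apply/path_edgesP; exists p.
by exists p => //; rewrite prod_vertex_var // (dpath_uniq dp).
Qed.

Lemma path_edges_nested : nested (fun i => level T (enum_val i)) path_edges.
Proof.
move=> _ _ v /path_edgesP[p dp ->] /path_edgesP[q dq ->]; rewrite !inE => vp vq.
apply/orP; case: (dpath_nested dp dq vp vq) => sub; [left|right];
  apply/subsetP => u; have := sub (enum_val u);
  by rewrite !mem_filter !inE ![_ && (_ <= _)%N]andbC.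
Qed.

End PathIdealEdges.

(** * The line graph inside the tree *)

Section LineInTree.
Variables (k : fieldType) (V : finType) (T : rooted_tree V) (n t : nat).
Variable gam : 'I_n -> V.
Hypothesis gamE : forall i j, dedge T (gam i) (gam j) = line_graph i j.
Hypothesis gam_inj : injective gam.

(** [var_incl] carries paths of the line to paths of the tree; [var_kill] sends a generator to 0 if
    its path leaves the image of [gam], and to a generator of the line otherwise. *)
Lemma pd_le_line_path l :
  pd_le l (quot_mod (path_ideal k (dedge T) t)) ->
  pd_le l (quot_mod (path_ideal k (@line_graph n) t)).
Proof.
pose iota (i : 'I_#|'I_n|) : 'I_#|V| := enum_rank (gam (enum_val i)).
have iota_inj : injective iota.
  by move=> i j /enum_rank_inj/gam_inj/enum_val_inj.
have iotaE i : iota (enum_rank i) = enum_rank (gam i) by rewrite /iota enum_rankK.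
have gam_path (p : seq 'I_n) :
    sorted (dedge T) (map gam p) = sorted (@line_graph n) p.
  by rewrite sorted_map; apply: eq_sorted => i j /=; rewrite gamE.
have inclE (p : seq 'I_n) : var_incl k iota (\prod_(v <- p) vertex_var k v) =
    \prod_(v <- map gam p) vertex_var k v.
  rewrite rmorph_prod big_map; apply: eq_bigr => v _.
  by rewrite var_inclX iotaE.
apply: (pd_le_quot_retract (var_inclK iota_inj)).
- exact: projective_var_incl.
- apply: ideal_gen_map => _ [p lp ->]; apply: mem_ideal_gen.
  by exists (map_tuple gam p); rewrite ?gam_path // inclE.
- apply: ideal_gen_map => _ [q dq ->].
  have [/allP qgam|/allPn[v vq vN]] := boolP (all (mem (codom gam)) q); last first.
    rewrite (perm_big _ (perm_to_rem vq)) big_cons rmorphM var_killX0.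
      by rewrite mul0r rpred0.
    apply: contra vN => /codomP[i /enum_rank_inj->]; exact: codom_f.
  have [p pq] : exists p : t.-tuple 'I_n, map gam p = q.
    pose p := [tuple iinv (qgam _ (mem_tnth i q)) | i < t].
    have pq : map_tuple gam p = q.
      by apply: eq_from_tnth => i; rewrite tnth_map tnth_mktuple f_iinv.
    by exists p; rewrite -[in RHS]pq.
  apply: mem_ideal_gen; exists p; first by rewrite -gam_path pq.
  by rewrite -pq -inclE (var_inclK iota_inj).
Qed.

End LineInTree.

Local Close Scope quotient_scope.
Local Close Scope ring_scope.
Unset Implicit Arguments.

Theorem theorem4p10 (k : fieldType) (V : finType) (T : rooted_tree V)
    (n t : nat) (hheight : height T = n - 1) (ht2 : 2 <= t) (htn : t <= n) :
  natinf_le (proj_dim (quot_mod (path_ideal k (@line_graph n) t)))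
            (proj_dim (quot_mod (path_ideal k (dedge T) t)))
  /\ natinf_le (proj_dim (quot_mod (path_ideal k (dedge T) t)))
               (ara (R := {mpoly k[#|V|]}) (path_ideal k (dedge T) t)).
Proof.
split; apply: natinf_min_mono => s.
  move=> /resolution_pd_le pd; apply/pd_le_resolution.
  (* The root path of a vertex of maximal level has [n] vertices and realizes the line graph. *)
  have [x xh] := height_ex T.
  have lt_n (i : 'I_n) : (i <= level T x)%N.
    by rewrite xh hheight subn1 -ltnS prednK // (leq_ltn_trans _ (ltn_ord i)).
  pose gam (i : 'I_n) := nth (Defs.root T) (Defs.root T :: root_path T x) i.
  have lev_gam i : level T (gam i) = i by apply: level_root_path.
  have gam_inj : injective gam.
    by move=> i j /(congr1 (level T)); rewrite !lev_gam => /val_inj.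
  apply: (@pd_le_line_path k V T n t gam _ gam_inj) pd => i j.
  have gamS (m : nat) (lt_m : (m.+1 < n)%N) :
      dedge T (gam (Ordinal (ltnW lt_m))) (gam (Ordinal lt_m)).
    by apply: dedge_nth_root_path; apply: (lt_n (Ordinal lt_m)).
  (* Levels exclude an edge into the root; any other vertex of the path has its predecessor there as
     unique parent. *)
  apply/idP/eqP => [dij|ji].
    case: j dij => [[|j] lt_j] dij.
      by move: dij => /andP[_]; rewrite !lev_gam.
    by have /gam_inj -> := dedge_parent_inj dij (gamS _ lt_j).
  case: j ji => j lt_j /= ji; subst j.
  by have := gamS _ lt_j; congr (dedge _ (gam _) _); apply: val_inj.
(* The [s] polynomials bound every minimal cover by [s], and the covers bound the dimension. *)
move=> [f radE]; apply/pd_le_resolution.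
have eqE := @path_ideal_edges k V T t.
apply: (pd_le_quot_eq (W1 := edge_ideal k (path_edges T t))) => [x|].
  by rewrite eqE.
apply: pd_le_edge_ideal (@path_edges_nested V T t) _ => Q mQ.
apply: (min_cover_le_ara (f := f) mQ) => x; rewrite -radE.
by apply: asbool_equiv_eq; split=> -[m]; exists m; rewrite ?eqE // -eqE.
Qed.
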